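(* Let $\{\mu_n\}_{n>0}$ be a sequence of probability measures on $\mathbb{R}$, each with mean $0$ and variance $1$, and each infinitely divisible with respect to monotone convolution $\rhd$. Let $X_n$ be a random variable with distribution $\mu_n$. If $E[X_n^4]=\int_{\mathbb{R}}x^4\,\mu_n(dx)\to \frac{3}{2}$ as $n\to\infty$, then $\mu_n$ converges weakly to $\mathcal{A}(0,1)$, the arcsine distribution with mean $0$ and variance $1$.
   Context: The arcsine distribution $\mathcal{A}(0,1)$ has density $\frac{1}{\pi\sqrt{2-x^2}}$ on $(-\sqrt{2},\sqrt{2})$. For a probability measure $\mu$ on $\mathbb{R}$, let $G_\mu(z)=\int_{\mathbb{R}}\frac{\mu(dx)}{z-x}$ for $z\in\mathbb{C}^+$ (the open upper half-plane) and $F_\mu=1/G_\mu$. The monotone convolution $\mu_1\rhd\mu_2$ is the unique probability measure on $\mathbb{R}$ with $F_{\mu_1\rhd\mu_2}(z)=F_{\mu_1}(F_{\mu_2}(z))$ for all $z\in\mathbb{C}^+$. A probability measure $\mu$ is $\rhd$-infinitely divisible, written $\mu\in ID(\rhd)$, if for every $N\in\mathbb{N}$ there is a probability measure $\nu_N$ on $\mathbb{R}$ with $\mu=\nu_N^{\rhd N}$ ($N$-fold $\rhd$-convolution power). *)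

(* Defs.v *)
From HB Require Import structures.
From mathcomp Require Import all_boot all_order all_algebra.
From mathcomp Require Import complex.
From mathcomp Require Import all_classical all_reals all_analysis.
From mathcomp Require Import measurable_realfun.

Set Implicit Arguments.
Unset Strict Implicit.
Unset Printing Implicit Defensive.
Import Order.TTheory GRing.Theory Num.Theory.
Import numFieldNormedType.Exports.
Local Open Scope classical_set_scope.
Local Open Scope ring_scope.
Local Open Scope complex_scope.

Notation borel_probability R := (probability (measurableTypeR R) R).

(* The library has no integral of complex-valued functions; the Cauchy
   transform is integrated componentwise. *)
Definition cauchy_transform {R : realType} (mu : borel_probability R)
    (z : R[i]) : R[i] :=
  (\int[mu]_x complex.Re (z - x%:C)^-1) +i*
  (\int[mu]_x complex.Im (z - x%:C)^-1).

Definition reciprocal_cauchy {R : realType} (mu : borel_probability R)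
    (z : R[i]) : R[i] := (cauchy_transform mu z)^-1.

(* [is_monotone_conv mu1 mu2 mu] reads "mu is the monotone convolution of mu1
   and mu2"; it is a relation because the equation on F determines mu. *)
Definition is_monotone_conv {R : realType}
    (mu1 mu2 mu : borel_probability R) : Prop :=
  forall z : R[i], 0 < complex.Im z ->
    reciprocal_cauchy mu z = reciprocal_cauchy mu1 (reciprocal_cauchy mu2 z).

(* [is_monotone_pow nu N mu] reads "mu is the N-fold monotone convolution
   power of nu", for N >= 1. *)
Inductive is_monotone_pow {R : realType} (nu : borel_probability R) :
    nat -> borel_probability R -> Prop :=
| monotone_pow1 : is_monotone_pow nu 1 nu
| monotone_powS N rho mu :
    is_monotone_pow nu N rho -> is_monotone_conv rho nu mu ->
    is_monotone_pow nu N.+1 mu.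

Definition monotone_infinitely_divisible {R : realType}
    (mu : borel_probability R) : Prop :=
  forall N : nat, (0 < N)%N ->
    exists nu : borel_probability R, is_monotone_pow nu N mu.

Definition weak_cvg {R : realType} (mu : nat -> borel_probability R)
    (nu : borel_probability R) : Prop :=
  forall f : R -> R, continuous f -> bounded_fun f ->
    (\int[mu n]_x f x) @[n --> \oo] --> \int[nu]_x f x.

Definition arcsine_pdf {R : realType} (x : R) : R :=
  if - Num.sqrt 2 < x < Num.sqrt 2 then (pi * Num.sqrt (2 - x ^+ 2))^-1 else 0.

Definition arcsine_prob (R : realType) : set (measurableTypeR R) -> \bar R :=
  fun V => (\int[lebesgue_measure]_(x in V) (arcsine_pdf x)%:E)%E.
Arguments arcsine_prob : clear implicits.

Section arcsine.
Context {R : realType}.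
Notation mu := (@lebesgue_measure R).
Let s : R := Num.sqrt 2.

Let s_gt0 : 0 < s. Proof. by rewrite sqrtr_gt0. Qed.
Let s2 : s ^+ 2 = 2. Proof. by rewrite sqr_sqrtr. Qed.

Lemma arcsine_pdf_ge0 (x : R) : 0 <= arcsine_pdf x.
Proof.
rewrite /arcsine_pdf; case: ifP => // _.
by rewrite invr_ge0 mulr_ge0 ?pi_ge0 ?sqrtr_ge0.
Qed.

Let rt_gt0 (x : R) : - s < x < s -> 0 < 2 - x ^+ 2.
Proof.
move=> xs; rewrite subr_gt0 -s2 -[x ^+ 2]real_normK ?num_real//.
by rewrite ltr_pXn2r ?nnegrE ?normr_ge0 ?(ltW s_gt0)// ltr_norml.
Qed.

Let g (x : R) := (pi * Num.sqrt (2 - x ^+ 2))^-1.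

Let arcsine_pdfE : arcsine_pdf = g \_ `]- s, s[.
Proof.
apply/funext => x; rewrite patchE /arcsine_pdf.
by rewrite (_ : (x \in _) = (- s < x < s))// mem_setE in_itv.
Qed.

Let g_cont (x : R) : - s < x < s -> {for x, continuous g}.
Proof.
move=> xs; have h := rt_gt0 xs.
apply: cvgV; first by rewrite mulf_neq0 ?gt_eqF ?pi_gt0 ?sqrtr_gt0.
apply: cvgM; first exact: cvg_cst.
apply: (cvg_comp (fun x : R => 2 - x ^+ 2) (@Num.sqrt R)).
  by apply: cvgB; [exact: cvg_cst|exact: exprn_continuous].
exact: sqrt_continuous.
Qed.

Lemma measurable_arcsine_pdf : measurable_fun [set: R] (@arcsine_pdf R).
Proof.
rewrite arcsine_pdfE.
apply/(measurable_restrictT _ _).1 => //.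
apply: subspace_continuous_measurable_fun => //.
apply: continuous_in_subspaceT => x; rewrite inE/= in_itv/=.
exact: g_cont.
Qed.

Let F (x : R) := asin (x / s) / pi.

Let xs_itv (x : R) : - s < x < s -> -1 < x / s < 1.
Proof.
by move=> /andP[h1 h2]; rewrite ltr_pdivlMr// mulN1r h1 ltr_pdivrMr// mul1r.
Qed.

Let F_derive (x : R) : - s < x < s -> is_derive x 1 F (g x).
Proof.
move=> xs.
have d1 : is_derive x 1 (fun x : R => x / s) s^-1.
  rewrite [X in is_derive _ _ X _](_ : _ = (s^-1 \*: (@id R : R -> R^o))); last first.
    by apply/funext => y /=; rewrite mulrC.
  apply: is_derive_eq.
  by rewrite /GRing.scale/= mulr1.
have d2 := is_derive1_asin (xs_itv xs).
have d3 := @is_derive1_comp R asin (fun x : R => x / s) x _ _ d2 d1.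
rewrite [X in is_derive _ _ X _](_ : _ = pi^-1 \*: ((@asin R \o (fun x => x / s)) : R -> R^o)); last first.
  by apply/funext => y /=; rewrite /F mulrC.
apply: is_derive_eq.
rewrite /GRing.scale/= /g invfM; congr (_ * _).
rewrite -invfM; congr (_^-1).
rewrite -{1}[s]ger0_norm ?(ltW s_gt0)// -sqrtr_sqr mulrC -sqrtrM ?sqr_ge0//.
rewrite s2 expr_div_n s2; congr (Num.sqrt _).
by rewrite mulrBr mulr1 mulrC divfK.
Qed.

Let u (n : nat) : R := 1 - n.+2%:R^-1.
Let t (n : nat) : R := pi / 2 * u n.
Let b (n : nat) : R := s * sin (t n).

Let pih_gt0 : 0 < pi / 2 :> R. Proof. by rewrite divr_gt0 ?pi_gt0. Qed.

Let t_itv n : 0 < t n < pi / 2.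
Proof.
rewrite /t mulr_gt0//=; last by rewrite subr_gt0 invf_lt1// ltr1n.
by rewrite gtr_pMr// ltrBlDr ltrDl invr_gt0.
Qed.

Let t_in n : t n \in `[- (pi / 2), pi / 2].
Proof.
have /andP[t0 t1] := t_itv n; rewrite in_itv/= (ltW t1) andbT.
by rewrite (le_trans _ (ltW t0))// oppr_le0 ltW.
Qed.

Let tN_in n : - t n \in `[- (pi / 2), pi / 2].
Proof. by move: (t_in n); rewrite !in_itv/= lerN2 lerNl andbC. Qed.

Let sin_mono : {in `[- (pi / 2), pi / 2 : R] &, {mono sin : x y / x <= y}}.
Proof.
move=> x y xI yI; case: (ltgtP x y) => [xy|xy|->]; last by rewrite lexx.
- by apply/ltW; rewrite ltr_sin.
- by apply/negbTE; rewrite -ltNge ltr_sin.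
Qed.

Let u_cvg : u @ \oo --> (1 : R).
Proof.
rewrite -[X in _ --> X]subr0; apply: cvgB; first exact: cvg_cst.
by move: (@cvg_harmonic R); rewrite -cvg_shiftS.
Qed.

Let u_nd : nondecreasing_seq u.
Proof.
by move=> n m nm; rewrite lerD2l lerN2 lef_pV2 ?posrE// ler_nat.
Qed.

Let b_itv n : 0 < b n < s.
Proof.
have /andP[t0 t1] := t_itv n.
rewrite mulr_gt0 ?sin_gt0_pihalf ?t0//=.
rewrite gtr_pMr// -(@sin_pihalf R) ltr_sin// in_itv/= lexx andbT.
by rewrite (le_trans _ (ltW pih_gt0))// oppr_le0 ltW.
Qed.

Let b_sub n (x : R) : - b n <= x <= b n -> - s < x < s.
Proof.
have /andP[_ bs] := b_itv n => /andP[h1 h2].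
by rewrite (le_lt_trans h2 bs) (lt_le_trans _ h1)// ltrN2.
Qed.

Let b_nd : nondecreasing_seq b.
Proof.
by move=> n m nm; rewrite ler_pM2l// sin_mono ?t_in// ler_pM2l// u_nd.
Qed.

Let integral_g n :
  (\int[mu]_(x in `[(- b n)%R, b n]) (g x)%:E)%E = (u n)%:E.
Proof.
have /andP[b0 bs] := b_itv n.
have bb : - b n < b n by rewrite gtrN.
have bK : b n / s = sin (t n) by rewrite /b mulrC mulKf ?gt_eqF.
rewrite (@continuous_FTC2 _ g F)//.
- rewrite /F mulNr bK -sinN !sinK//.
  rewrite -EFinB mulNr opprK -mulrDl /t -mulrDl -splitr.
  by rewrite mulrAC divff ?mul1r ?gt_eqF ?pi_gt0.
- apply: continuous_in_subspaceT => x; rewrite inE/= in_itv/= => /b_sub.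
  exact: g_cont.
- have Fc x : - s < x < s -> {for x, continuous F}.
    move=> /F_derive dF; apply/differentiable_continuous/derivable1_diffP.
    exact: ex_derive.
  split.
  + move=> x; rewrite in_itv/= => /andP[/ltW h1 /ltW h2].
    by have := F_derive (b_sub (introT andP (conj h1 h2))) => dF; exact: ex_derive.
  + by apply: cvg_at_right_filter; apply: Fc; rewrite (@b_sub n)// lexx ltW.
  + by apply: cvg_at_left_filter; apply: Fc; rewrite (@b_sub n)// lexx ltW.
- move=> x; rewrite in_itv/= => /andP[/ltW h1 /ltW h2].
  have := F_derive (b_sub (introT andP (conj h1 h2))) => dF.
  by rewrite derive1E derive_val.
Qed.

Let bigcup_b : \bigcup_n `[- b n, b n]%classic = `]- s, s[%classic.
Proof.
apply/seteqP; split=> x /=; first by move=> [n _]/=; rewrite !in_itv/= => /b_sub.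
rewrite in_itv/= => xs; have /andP[y1 y2] := xs_itv xs.
set a := asin (x / s).
have yI : -1 <= x / s <= 1 by rewrite !ltW.
have a1 : - (pi / 2) < a by rewrite asin_gtNpi2// y1 ltW.
have a2 : a < pi / 2 by rewrite asin_ltpi2// y2 andbT ltW.
have ax : x = s * sin a by rewrite asinK ?in_itv//= mulrC divfK ?gt_eqF.
have tc : t @ \oo --> (pi / 2 : R).
  by rewrite -[X in _ --> X]mulr1; apply: cvgM; [exact: cvg_cst|exact: u_cvg].
have [N _ HN] : \forall n \near \oo, `|a| < t n.
  by apply: (cvgr_gt _ tc); rewrite ltr_norml a1.
have := HN N (leqnn N); rewrite /= ltr_norml => /andP[h1 h2].
exists N => //=; rewrite in_itv/= ax /b -mulrN -sinN.
by rewrite !ler_pM2l// !sin_mono ?t_in ?tN_in ?ltW//= in_itv/= !ltW.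
Qed.

Lemma integral_arcsine_pdf : (\int[mu]_x (arcsine_pdf x)%:E = 1%E)%E.
Proof.
have -> : (\int[mu]_x (arcsine_pdf x)%:E =
           \int[mu]_(x in `](- s)%R, s[) (g x)%:E)%E.
  rewrite [RHS]integral_mkcond; apply: eq_integral => x _.
  by rewrite arcsine_pdfE !patchE; case: ifP.
rewrite -bigcup_b.
have mg : measurable_fun `]- s, s[%classic (EFin \o g).
  apply/measurable_EFinP/(measurable_restrictT _ _).2 => //.
  rewrite -arcsine_pdfE; exact: measurable_arcsine_pdf.
have bs n : `[- b n, b n]%classic `<=` `]- s, s[%classic.
  by move=> x /=; rewrite !in_itv/=; exact: b_sub.
have := @ge0_nondecreasing_set_cvg_integral _ (measurableTypeR R) R
  (fun n => `[- b n, b n]%classic) (EFin \o g) mu.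
move=> /(_ _ _ _ _)/cvg_lim <- //.
- under eq_fun do rewrite integral_g.
  by apply/cvg_lim => //; apply: cvg_EFin; [near=> n|exact: u_cvg].
- move=> n m nm; apply/subsetPset => x /=; rewrite !in_itv/= => /andP[h1 h2].
  by rewrite (le_trans _ h1) ?lerN2 ?b_nd//= (le_trans h2)// b_nd.
- by move=> n; exact: measurable_funS mg.
- by move=> n x _; rewrite lee_fin invr_ge0 mulr_ge0 ?pi_ge0 ?sqrtr_ge0.
Unshelve. all: by end_near. Qed.

Let arcsine0 : arcsine_prob R set0 = 0%E.
Proof. by rewrite /arcsine_prob integral_set0. Qed.

Let arcsine_ge0 A : (0 <= arcsine_prob R A)%E.
Proof. by apply: integral_ge0 => x _; rewrite lee_fin arcsine_pdf_ge0. Qed.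

Let arcsine_sigma_additive : semi_sigma_additive (arcsine_prob R).
Proof.
move=> /= A mA tA mUA; rewrite /arcsine_prob; apply: cvg_toP.
  apply: ereal_nondecreasing_is_cvgn => m n mn.
  apply: lee_sum_nneg_natr => // k _ _.
  by apply: integral_ge0 => /= x _; rewrite lee_fin arcsine_pdf_ge0.
rewrite ge0_integral_bigcup//=.
- apply: measurable_funTS; apply: measurableT_comp => //.
  exact: measurable_arcsine_pdf.
- by move=> x _; rewrite lee_fin arcsine_pdf_ge0.
Qed.

HB.instance Definition _ := isMeasure.Build _ _ _
  (arcsine_prob R) arcsine0 arcsine_ge0 arcsine_sigma_additive.

Let arcsine_setT : arcsine_prob R [set: _] = 1%E.
Proof. exact: integral_arcsine_pdf. Qed.

HB.instance Definition _ :=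
  @Measure_isProbability.Build _ _ R (arcsine_prob R) arcsine_setT.

End arcsine.

(* Main.v *)
Require Import Defs.
From HB Require Import structures.
From mathcomp Require Import all_boot all_order all_algebra.
From mathcomp Require Import complex ring lra.
From mathcomp Require Import all_classical all_reals all_analysis.
From mathcomp Require Import measurable_realfun.

(** Let s be the variance of a centred measure nu and F = 1 / G its reciprocal
    Cauchy transform. To leading order F(z)^2 = z^2 - 2 s, with an increment
    that does not depend on z. Hence if mu is an N-fold monotone convolution
    power of nu, so that F_mu is the N-th iterate of F, the squares telescope:
    F_mu(z)^2 - z^2 is about - 2 N s = - 2 when mu has variance one. For
    the arcsine law F(z)^2 = z^2 - 2 exactly, and the fourth moment decides how
    good the approximation is.

    The moments of the root nu are obtained by following the orbit of iy under F
    as y grows. Orbits only move up ([Im_reciprocal_cauchy_ge]), so the first step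
    rises no more than all N steps together, and this bounds the variance of
    nu ([root_has_moment2]). Comparing the expansions of F_mu and of the iterate
    to successive orders gives mean zero ([root_moment1]), s = 1 / N
    ([root_moment2]), and, with m4 the fourth moment of mu, a fourth moment of nu
    at most (m4 - 3/2 + 8/N) / N ([root_moment4]). The constant 3/2 arises since
    F_mu(iy)^2 + y^2 has real part - 2 + (2 m4 - 3) / y^2 + o(1 / y^2).

    So the third absolute moment of the root is small compared with 1 / N when m4
    is close to 3/2 and N is large. It governs the error of one step, and summing
    N steps gives the quantitative statement [reciprocal_cauchy_arcsine_bound]:
    for every th > 0,
    |F_mu(z)^2 - z^2 + 2| <= (th + (m4 - 3/2) / th) / Im z.

    Weak convergence follows by Stieltjes inversion. Above a point t of the open
    support F_mu(t + iy)^2 is close to t^2 - 2 < 0, and F_mu lies in the upper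
    half-plane, so F_mu is close to i sqrt (2 - t^2) and - Im G_mu / pi is at least
    nearly the arcsine density. This bounds the integrals of nonnegative continuous
    functions from below ([arcsine_le_liminf]). Since all the measures have mass
    one, lower bounds for B + f and for B - f with B >= |f| are enough. *)

Set Implicit Arguments.
Unset Strict Implicit.
Unset Printing Implicit Defensive.

Import Order.TTheory GRing.Theory Num.Theory.
Import numFieldNormedType.Exports.
Import ComplexField.Normc.
Local Open Scope classical_set_scope.
Local Open Scope ring_scope.
Local Open Scope complex_scope.

(** * Modulus, real and imaginary parts of complex numbers *)

Section complex_modulus.
Context {R : realType}.
Implicit Types (z w : R[i]) (x : R).

Notation Re := complex.Re.
Notation Im := complex.Im.

Lemma normc_sqrE z : normc z ^+ 2 = Re z ^+ 2 + Im z ^+ 2.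
Proof. by case: z => a b /=; rewrite sqr_sqrtr// addr_ge0// sqr_ge0. Qed.

Lemma normc_ge0 z : 0 <= normc z.
Proof. by case: z => a b /=; rewrite sqrtr_ge0. Qed.

Lemma normc_gt0 z : (0 < normc z) = (z != 0).
Proof.
rewrite lt_def normc_ge0 andbT; congr negb; apply/eqP/eqP => [/eq0_normc//|->].
exact: normc0.
Qed.

Lemma normcXn z n : normc (z ^+ n) = normc z ^+ n.
Proof.
by elim: n => [|n ih]; rewrite ?expr0 ?normc1// !exprS normcM ih.
Qed.

Lemma normc_Neg z : normc (- z) = normc z.
Proof. by case: z => a b /=; rewrite !sqrrN. Qed.

Lemma normc_real x : normc x%:C = `|x|.
Proof. by rewrite /= expr0n/= addr0 sqrtr_sqr. Qed.

Lemma normc_le_add z w : normc (z + w) <= normc z + normc w.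
Proof. by rewrite -lecR rmorphD/=; exact: (@ler_normD _ R[i]). Qed.

Lemma normc_le_sub z w : normc (z - w) <= normc z + normc w.
Proof. by rewrite (le_trans (normc_le_add _ _))// normc_Neg. Qed.

Lemma le_normc_sub z w : normc z - normc w <= normc (z + w).
Proof.
by rewrite lerBlDr -[in leLHS](addrK w z) (le_trans (normc_le_add _ _))// normc_Neg.
Qed.

Lemma normc_sum n (f : 'I_n -> R[i]) :
  normc (\sum_(i < n) f i) <= \sum_(i < n) normc (f i).
Proof.
elim/big_ind2 : _ => //; first by rewrite normc0.
by move=> a x b y ha hb; rewrite (le_trans (normc_le_add _ _))// lerD.
Qed.

Lemma Re_le_normc z : `|Re z| <= normc z.
Proof.
by rewrite -ler_sqr ?nnegrE ?normc_ge0// normc_sqrE real_normK ?num_real// lerDl sqr_ge0.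
Qed.

Lemma Im_le_normc z : `|Im z| <= normc z.
Proof.
by rewrite -ler_sqr ?nnegrE ?normc_ge0// normc_sqrE real_normK ?num_real// lerDr sqr_ge0.
Qed.

Lemma cReD z w : Re (z + w) = Re z + Re w. Proof. by case: z; case: w. Qed.
Lemma cImD z w : Im (z + w) = Im z + Im w. Proof. by case: z; case: w. Qed.
Lemma cReN z : Re (- z) = - Re z. Proof. by case: z. Qed.
Lemma cImN z : Im (- z) = - Im z. Proof. by case: z. Qed.
Lemma cReM z w : Re (z * w) = Re z * Re w - Im z * Im w.
Proof. by case: z; case: w. Qed.
Lemma cImM z w : Im (z * w) = Re z * Im w + Im z * Re w.
Proof. by case: z; case: w. Qed.
Lemma cReV z : Re z^-1 = Re z / normc z ^+ 2.
Proof. by rewrite normc_sqrE; case: z. Qed.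
Lemma cImV z : Im z^-1 = - Im z / normc z ^+ 2.
Proof. by rewrite normc_sqrE; case: z => a b; rewrite mulNr. Qed.

Lemma cRe_realM x z : Re (x%:C * z) = x * Re z.
Proof. by rewrite cReM/= mul0r subr0. Qed.

Lemma cRe_natM (n : nat) z : Re (n%:R * z) = n%:R * Re z.
Proof. by rewrite -(rmorph_nat (real_complex R)) cRe_realM. Qed.

Lemma cRe_sum n (f : 'I_n -> R[i]) : Re (\sum_(i < n) f i) = \sum_(i < n) Re (f i).
Proof. by elim/big_ind2 : _ => // a x b y <- <-; rewrite cReD. Qed.

Lemma complex_eq z w : Re z = Re w -> Im z = Im w -> z = w.
Proof. by case: z; case: w => /= ? ? ? ? -> ->. Qed.

Lemma Im_neq0 z : 0 < Im z -> z != 0.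
Proof. by move=> z0; apply/eqP => z0'; move: z0; rewrite z0' ltxx. Qed.

Lemma Im_subr z x : Im (z - x%:C) = Im z.
Proof. by rewrite cImD cImN/= subr0. Qed.

Lemma Re_subr z x : Re (z - x%:C) = Re z - x.
Proof. by rewrite cReD cReN/=. Qed.

Lemma subr_neq0 z x : 0 < Im z -> z - x%:C != 0.
Proof. by move=> z0; apply: Im_neq0; rewrite Im_subr. Qed.

Lemma normc_subr z x : 0 < Im z -> Im z <= normc (z - x%:C).
Proof.
move=> z0; rewrite -[leLHS]gtr0_norm// -(Im_subr z x); exact: Im_le_normc.
Qed.

Lemma normc_resolvent z x : 0 < Im z -> normc (z - x%:C)^-1 <= (Im z)^-1.
Proof.
move=> z0; rewrite normcV lef_pV2 ?posrE ?normc_subr//.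
by rewrite (lt_le_trans z0)// normc_subr.
Qed.

End complex_modulus.

(** * Integration of real functions against a probability measure *)

Section real_integral.
Context {R : realType}.
Variable mu : borel_probability R.
Implicit Types (f g : R -> R).

Definition integrableR (f : R -> R) := mu.-integrable [set: R] (EFin \o f).

Lemma integrableR_meas f : integrableR f -> measurable_fun [set: R] f.
Proof. by move=> /integrableP[/measurable_EFinP]. Qed.

Lemma integrableR_le (g f : R -> R) : measurable_fun [set: R] f ->
  (forall x, `|f x| <= g x) -> integrableR g -> integrableR f.
Proof.
move=> mf fg; apply: le_integrable => //; first exact/measurable_EFinP.
by move=> x _ /=; rewrite lee_fin (le_trans (fg x))// ler_norm.
Qed.

Lemma integrableR_cst c : integrableR (fun=> c).
Proof. exact: finite_measure_integrable_cst. Qed.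

Lemma integrableR_bounded (c : R) (f : R -> R) : measurable_fun [set: R] f ->
  (forall x, `|f x| <= c) -> integrableR f.
Proof. by move=> mf fc; apply: (integrableR_le mf fc); exact: integrableR_cst. Qed.

Lemma integrableRD f g : integrableR f -> integrableR g -> integrableR (fun x => f x + g x).
Proof. exact: integrableD. Qed.

Lemma integrableRB f g : integrableR f -> integrableR g -> integrableR (fun x => f x - g x).
Proof. exact: integrableB. Qed.

Lemma integrableRZ c f : integrableR f -> integrableR (fun x => c * f x).
Proof. exact: integrableZl. Qed.

Lemma integrableR_norm f : integrableR f -> integrableR (fun x => `|f x|).
Proof. exact: integrable_norm. Qed.

Lemma integrableR_sum n (f : 'I_n -> R -> R) : (forall i, integrableR (f i)) ->
  integrableR (fun x => \sum_(i < n) f i x).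
Proof.
move=> fi.
have := @integrable_sum _ _ _ mu _ measurableT _ (index_enum 'I_n) xpredT
  (fun i => EFin \o f i) (fun i _ => fi i).
apply: eq_integrable => // x _ /=.
by rewrite sumEFin.
Qed.

Lemma RintD f g : integrableR f -> integrableR g ->
  \int[mu]_x (f x + g x) = \int[mu]_x f x + \int[mu]_x g x.
Proof. exact: RintegralD. Qed.

Lemma RintB f g : integrableR f -> integrableR g ->
  \int[mu]_x (f x - g x) = \int[mu]_x f x - \int[mu]_x g x.
Proof. exact: RintegralB. Qed.

Lemma RintZ c f : integrableR f -> \int[mu]_x (c * f x) = c * \int[mu]_x f x.
Proof. exact: RintegralZl. Qed.

Lemma Rint_cst (c : R) : \int[mu]_x c = c.
Proof.
rewrite Rintegral_cst//.
transitivity (c * fine 1%E); last by rewrite mulr1.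
by congr (c * fine _); exact: probability_setT.
Qed.

Lemma Rint_sum n (f : 'I_n -> R -> R) : (forall i, integrableR (f i)) ->
  \int[mu]_x (\sum_(i < n) f i x) = \sum_(i < n) \int[mu]_x f i x.
Proof.
elim: n f => [|n ih] f fi.
  by under eq_Rintegral do rewrite big_ord0; rewrite Rint_cst big_ord0.
under eq_Rintegral do rewrite big_ord_recr/=.
rewrite RintD// ?big_ord_recr ?ih//=.
exact: integrableR_sum.
Qed.

Lemma Rint_le f g : integrableR f -> integrableR g -> (forall x, f x <= g x) ->
  \int[mu]_x f x <= \int[mu]_x g x.
Proof. by move=> ? ? fg; exact: le_Rintegral. Qed.

Lemma Rint_ge0 f : (forall x, 0 <= f x) -> 0 <= \int[mu]_x f x.
Proof. by move=> f0; exact: Rintegral_ge0. Qed.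

Lemma Rint_EFin f : integrableR f -> (\int[mu]_x (f x)%:E)%E = (\int[mu]_x f x)%:E.
Proof. by move=> fi; rewrite /Rintegral fineK//; exact: integrable_fin_num fi. Qed.

Lemma Rint_gt0 f : integrableR f -> (forall x, 0 < f x) -> 0 < \int[mu]_x f x.
Proof.
move=> fi f0; rewrite lt_def Rint_ge0 ?andbT; last by move=> x; exact: ltW.
apply/eqP => If0.
have mf := integrableR_meas fi.
have : (\int[mu]_x `|(EFin \o f) x| = 0)%E.
  under eq_integral do rewrite /= gtr0_norm//.
  by rewrite Rint_EFin// If0.
have mE : measurable_fun [set: R] (EFin \o f) by exact/measurable_EFinP.
move/ae_eq_integral_abs => /(_ measurableT mE)[A [mA A0 fA]].
have AT : A = setT.
  apply/seteqP; split => // x _; apply: fA => /= /(_ I) [] fx0.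
  by move: (f0 x); rewrite fx0 ltxx.
by have := probability_setT mu; rewrite -[X in mu X]AT A0 => /eqP; rewrite eq_sym onee_eq0.
Qed.

(** Jensen's inequality: the variance is nonnegative. *)
Lemma Rint_sqr_le f : integrableR f -> integrableR (fun x => f x ^+ 2) ->
  (\int[mu]_x f x) ^+ 2 <= \int[mu]_x (f x ^+ 2).
Proof.
move=> fi f2i; set m := \int[mu]_x f x.
have : 0 <= \int[mu]_x ((f x - m) ^+ 2) by apply: Rint_ge0 => x; exact: sqr_ge0.
have fE x : (f x - m) ^+ 2 = (f x ^+ 2 - (2 * m) * f x) + m ^+ 2 by ring.
under eq_Rintegral do rewrite fE.
rewrite RintD ?Rint_cst ?RintB ?RintZ//; first by rewrite -/m; lra.
- exact: integrableRZ.
- by apply: integrableRB => //; exact: integrableRZ.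
- exact: integrableR_cst.
Qed.

(** Fatou's lemma in the form used to bound a moment by the limit of truncated
    moments: integrability of the pointwise limit is part of the conclusion. *)
Lemma Fatou_cvg (f_ : nat -> R -> R) f (c_ : nat -> R) (c : R) :
  (forall n, measurable_fun [set: R] (f_ n)) -> (forall n x, 0 <= f_ n x) ->
  measurable_fun [set: R] f ->
  (forall x, f_ n x @[n --> \oo] --> f x) ->
  (\forall n \near \oo, integrableR (f_ n) /\ \int[mu]_x f_ n x <= c_ n) ->
  c_ n @[n --> \oo] --> c ->
  integrableR f /\ \int[mu]_x f x <= c.
Proof.
move=> mf_ f0 mf ff fc cc.
have f_ge0 x : 0 <= f x.
  have <- := cvg_lim (@Rhausdorff R) (ff x).
  by apply: limr_ge; [apply/cvg_ex; exists (f x); exact: ff|near=> n; exact: f0].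
have ifc : (\int[mu]_x (f x)%:E <= c%:E)%E.
  have mE n : measurable_fun [set: R] (EFin \o f_ n).
    by apply/measurable_EFinP; exact: mf_.
  have E0 n x : [set: R] x -> (0 <= (EFin \o f_ n) x)%E by rewrite lee_fin.
  have := @fatou _ _ _ mu _ measurableT (fun n => EFin \o f_ n) mE E0.
  have -> : (\int[mu]_x limn_einf ((fun n => EFin \o f_ n)^~ x) =
             \int[mu]_x (f x)%:E)%E.
    apply: eq_integral => x _.
    by apply: (cvg_limn_einf_sup _).1; apply: cvg_EFin; [near=> n|exact: ff].
  move=> /le_trans; apply.
  rewrite limn_einf_lim.
  have cE : (c_ n)%:E @[n --> \oo] --> c%:E by apply: cvg_EFin; [near=> n|].
  have <- := cvg_lim (@ereal_hausdorff R) cE.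
  apply: lee_lim.
  - exact: is_cvg_einfs.
  - by apply/cvg_ex; exists c%:E.
  - near=> n.
    have [fni fnc] : integrableR (f_ n) /\ \int[mu]_x f_ n x <= c_ n by near: n.
    apply: (@le_trans _ _ (\int[mu]_x (f_ n x)%:E)%E).
      by apply: ereal_inf_lbound; exists n => /=.
    by rewrite Rint_EFin// lee_fin.
have fi : integrableR f.
  apply/integrableP; split; first exact/measurable_EFinP.
  under eq_integral do rewrite /= ger0_norm//.
  by rewrite (le_lt_trans ifc)// ltry.
by split => //; rewrite -lee_fin -Rint_EFin.
Unshelve. all: by end_near. Qed.

Lemma dominated_cvg_Rint (f_ : nat -> R -> R) f g :
  (forall n, measurable_fun [set: R] (f_ n)) -> measurable_fun [set: R] f ->
  (forall x, f_ n x @[n --> \oo] --> f x) -> integrableR g ->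
  (forall n x, `|f_ n x| <= g x) ->
  \int[mu]_x f_ n x @[n --> \oo] --> \int[mu]_x f x.
Proof.
move=> mf_ mf ff gi fg.
have [] := @dominated_convergence _ _ _ mu _ measurableT
  (fun n => EFin \o f_ n) (EFin \o f) (EFin \o g).
- by move=> n; apply/measurable_EFinP; exact: mf_.
- by apply/measurable_EFinP; exact: mf.
- apply: aeW => x _; apply: cvg_EFin; [near=> n|exact: ff] => //.
- exact: gi.
- by apply: aeW => x n _ /=; rewrite lee_fin.
move=> fi _ /=; rewrite Rint_EFin// => /fine_cvg; exact.
Unshelve. all: by end_near. Qed.

End real_integral.

(** * Integration of complex functions *)

Section complex_integral.
Context {R : realType}.
Variable mu : borel_probability R.
Implicit Types (f g : R -> R[i]) (c : R[i]).
Notation Re := complex.Re.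
Notation Im := complex.Im.

Definition measurableC f := measurable_fun [set: R] (fun x => Re (f x)) /\
  measurable_fun [set: R] (fun x => Im (f x)).

Definition integrableC f := integrableR mu (fun x => Re (f x)) /\ integrableR mu (fun x => Im (f x)).

Definition integralC f : R[i] := (\int[mu]_x Re (f x)) +i* (\int[mu]_x Im (f x)).

Lemma measurableC_real (h : R -> R) : measurable_fun [set: R] h -> measurableC (fun x => (h x)%:C).
Proof. by move=> mh; split => //=; exact: measurable_cst. Qed.

Lemma measurableCM f g : measurableC f -> measurableC g -> measurableC (fun x => f x * g x).
Proof.
move=> [? ?] [? ?]; split.
  by under eq_fun do rewrite cReM; apply: measurable_funB; exact: measurable_funM.
by under eq_fun do rewrite cImM; apply: measurable_funD; exact: measurable_funM.
Qed.

Lemma integrableC_le (g : R -> R) f : measurableC f -> (forall x, normc (f x) <= g x) ->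
  integrableR mu g -> integrableC f.
Proof.
move=> [mr mi] fg gi; split; apply: integrableR_le gi => // x; apply: le_trans (fg x).
  exact: Re_le_normc.
exact: Im_le_normc.
Qed.

Lemma integrableC_real (h : R -> R) : integrableR mu h -> integrableC (fun x => (h x)%:C).
Proof. by move=> hi; split => //=; exact: integrableR_cst. Qed.

Lemma integralC_real (h : R -> R) : integralC (fun x => (h x)%:C) = (\int[mu]_x h x)%:C.
Proof. by rewrite /integralC/= Rint_cst. Qed.

Lemma integralCD f g : integrableC f -> integrableC g -> integralC (fun x => f x + g x) = integralC f + integralC g.
Proof.
move=> [? ?] [? ?]; rewrite /integralC; apply: complex_eq; rewrite ?(cReD, cImD)/= -RintD//.
  by apply: eq_Rintegral => x _; rewrite cReD.
by apply: eq_Rintegral => x _; rewrite cImD.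
Qed.

Lemma integralCZ c f : integrableC f -> integralC (fun x => c * f x) = c * integralC f.
Proof.
move=> [fr fi]; apply: complex_eq; rewrite ?(cReM, cImM)/= -!RintZ//.
  rewrite -RintB; [|exact: integrableRZ..].
  by apply: eq_Rintegral => x _; rewrite cReM.
rewrite -RintD; [|exact: integrableRZ..].
by apply: eq_Rintegral => x _; rewrite cImM.
Qed.

Lemma eq_integralC f g : f =1 g -> integralC f = integralC g.
Proof. by move=> /funext ->. Qed.

(** Multiplying by the conjugate of the integral makes the integral real and
    nonnegative, and then only the real part of the integrand matters. *)
Lemma normc_integralC_le (g : R -> R) f : measurableC f -> integrableR mu g ->
  (forall x, normc (f x) <= g x) -> normc (integralC f) <= \int[mu]_x g x.
Proof.
move=> mf gi fg; have fi := integrableC_le mf fg gi.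
have [->|I0] := eqVneq (integralC f) 0.
  by rewrite normc0 Rint_ge0// => x; apply: le_trans (fg x); exact: normc_ge0.
have nI0 : 0 < normc (integralC f) by rewrite normc_gt0.
rewrite -(ler_pM2l nI0) -expr2 normc_sqrE -RintZ//.
have -> : Re (integralC f) ^+ 2 + Im (integralC f) ^+ 2 =
    \int[mu]_x (Re (integralC f) * Re (f x) + Im (integralC f) * Im (f x)).
  by rewrite RintD ?RintZ -?expr2//; [case: fi|case: fi|apply: integrableRZ; case: fi..].
apply: Rint_le; [|exact: integrableRZ|].
  by apply: integrableRD; apply: integrableRZ; case: fi.
move=> x; apply: (@le_trans _ _ (normc ((integralC f)^* * f x))); last first.
  rewrite normcM ler_pM ?normc_ge0//.
  by rewrite -ler_sqr ?nnegrE ?normc_ge0// !normc_sqrE; case: (integralC f) => a b /=; rewrite sqrrN.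
apply: le_trans (ler_norm _) _.
apply: le_trans _ (Re_le_normc _).
by rewrite cReM; case: (integralC f) => a b /=; rewrite mulNr opprK.
Qed.

End complex_integral.

(** * Cauchy transforms and moments *)

Section resolvent.
Context {R : realType}.
Implicit Types (z : R[i]) (x : R).
Notation Re := complex.Re.
Notation Im := complex.Im.

Lemma Re_resolvent z x :
  Re (z - x%:C)^-1 = (Re z - x) / ((Re z - x) ^+ 2 + Im z ^+ 2).
Proof. by rewrite cReV normc_sqrE Re_subr Im_subr. Qed.

Lemma Im_resolvent z x :
  Im (z - x%:C)^-1 = - Im z / ((Re z - x) ^+ 2 + Im z ^+ 2).
Proof. by rewrite cImV normc_sqrE Re_subr Im_subr. Qed.

Lemma sqr_dist_gt0 (y d : R) : 0 < y -> 0 < d ^+ 2 + y ^+ 2.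
Proof. by move=> y0; rewrite ltr_wpDl ?sqr_ge0// exprn_gt0. Qed.

Lemma measurable_inv_sqr_dist (u y : R) : 0 < y ->
  measurable_fun [set: R] (fun x : R => ((u - x) ^+ 2 + y ^+ 2)^-1).
Proof.
move=> y0; apply: continuous_measurable_fun => x.
apply: cvgV; first by rewrite gt_eqF// sqr_dist_gt0.
apply: cvgD; last exact: cvg_cst.
have h : {for x, continuous (fun t : R => u - t)}.
  by apply: cvgB; [exact: cvg_cst|exact: cvg_id].
exact: (continuous_comp h (@exprn_continuous _ 2 _)).
Qed.

Lemma measurableC_resolvent z : 0 < Im z -> measurableC (fun x => (z - x%:C)^-1).
Proof.
move=> z0; split.
  under eq_fun do rewrite Re_resolvent.
  apply: measurable_funM; last exact: measurable_inv_sqr_dist.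
  by apply: measurable_funB; [exact: measurable_cst|exact: measurable_id].
under eq_fun do rewrite Im_resolvent.
apply: measurable_funM; last exact: measurable_inv_sqr_dist.
exact: measurable_cst.
Qed.

Lemma measurable_pow n : measurable_fun [set: R] (fun x : R => x ^+ n).
Proof. exact: exprn_measurable. Qed.

End resolvent.

Section cauchy_moments.
Context {R : realType}.
Variable mu : borel_probability R.
Implicit Types (z : R[i]) (p : nat).
Notation Re := complex.Re.
Notation Im := complex.Im.

Definition moment p : R := \int[mu]_x (x ^+ p).
Definition abs_moment p : R := \int[mu]_x (`|x| ^+ p).
Definition has_moment p := integrableR mu (fun x => x ^+ p).

(** Up to lower-order terms, z^p times the Cauchy transform: see [cauchy_powS]. *)
Definition cauchy_pow p z : R[i] := integralC mu (fun x => (x ^+ p)%:C * (z - x%:C)^-1).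

Lemma has_moment_abs p : has_moment p -> integrableR mu (fun x => `|x| ^+ p).
Proof.
by move=> /integrableR_norm; under eq_fun do rewrite normrX.
Qed.

Lemma has_moment_le p q : (q <= p)%N -> has_moment p -> has_moment q.
Proof.
move=> qp hp; apply: (@integrableR_le _ _ (fun x => 1 + `|x| ^+ p)).
- exact: measurable_pow.
- move=> x; rewrite normrX; have [x1|x1] := lerP `|x| 1.
    by rewrite (@le_trans _ _ 1)// ?exprn_ile1// lerDl exprn_ge0.
  by rewrite (@le_trans _ _ (`|x| ^+ p))// ?lerDr// ler_weXn2l// ltW.
- by apply: integrableRD; [exact: integrableR_cst|exact: has_moment_abs].
Qed.

Lemma moment0 : moment 0 = 1.
Proof. by rewrite /moment; under eq_Rintegral do rewrite expr0; rewrite Rint_cst. Qed.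

Lemma abs_moment_even p : ~~ odd p -> abs_moment p = moment p.
Proof.
move=> op; apply: eq_Rintegral => x _; rewrite -normrX ger0_norm//.
exact: exprn_even_ge0.
Qed.

Lemma abs_moment_ge0 p : 0 <= abs_moment p.
Proof. by apply: Rint_ge0 => x; exact: exprn_ge0. Qed.

Lemma measurableC_pow_resolvent p z : 0 < Im z ->
  measurableC (fun x : R => (x ^+ p)%:C * (z - x%:C)^-1).
Proof.
move=> z0; apply: measurableCM; last exact: measurableC_resolvent.
by apply: measurableC_real; exact: measurable_pow.
Qed.

Lemma normc_pow_resolvent p z x : 0 < Im z ->
  normc ((x ^+ p)%:C * (z - x%:C)^-1) <= (Im z)^-1 * `|x| ^+ p.
Proof.
move=> z0; rewrite normcM normc_real normrX mulrC ler_wpM2r ?exprn_ge0//.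
exact: normc_resolvent.
Qed.

Lemma integrableC_pow_resolvent p z : 0 < Im z -> has_moment p ->
  integrableC mu (fun x => (x ^+ p)%:C * (z - x%:C)^-1).
Proof.
move=> z0 hp.
apply: (@integrableC_le _ _ (fun x => (Im z)^-1 * `|x| ^+ p)).
- exact: measurableC_pow_resolvent.
- by move=> x; exact: normc_pow_resolvent.
- by apply: integrableRZ; exact: has_moment_abs.
Qed.

Lemma normc_cauchy_pow p z : 0 < Im z -> has_moment p ->
  normc (cauchy_pow p z) <= abs_moment p / Im z.
Proof.
move=> z0 hp; rewrite mulrC -RintZ; last exact: has_moment_abs.
apply: normc_integralC_le.
- exact: measurableC_pow_resolvent.
- by apply: integrableRZ; exact: has_moment_abs.
- by move=> x; exact: normc_pow_resolvent.
Qed.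

(** Integrates z x^p / (z - x) = x^p + x^(p+1) / (z - x). Iterating it expands
    the Cauchy transform in inverse powers of z, with an explicit remainder as
    far as there are moments. *)
Lemma cauchy_powS p z : 0 < Im z -> has_moment p.+1 ->
  z * cauchy_pow p z = (moment p)%:C + cauchy_pow p.+1 z.
Proof.
move=> z0 hp1; have hp : has_moment p by exact: has_moment_le hp1.
rewrite -integralCZ; last exact: integrableC_pow_resolvent.
rewrite -integralC_real -integralCD; [|exact: integrableC_real|exact: integrableC_pow_resolvent].
apply: eq_integralC => x; have zx := subr_neq0 x z0.
rewrite exprS rmorphM/= -[z in z * _](subrK x%:C).
move: zx; move: (z - x%:C) => a a0; move: (x%:C) (real_complex_def _ _) => X P.
by rewrite mulrDl mulrCA divff// mulr1 mulrA.
Qed.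

Lemma cauchy_transformE z : cauchy_transform mu z = cauchy_pow 0 z.
Proof. by apply: eq_integralC => x; rewrite expr0 mul1r. Qed.

End cauchy_moments.

(** * The reciprocal Cauchy transform on the upper half-plane *)

Section half_plane.
Context {R : realType}.
Variable mu : borel_probability R.
Implicit Types (z : R[i]).
Notation Re := complex.Re.
Notation Im := complex.Im.
Notation G := (cauchy_transform mu).
Notation F := (reciprocal_cauchy mu).

Lemma integrableR_inv_sqr_dist (u y : R) : 0 < y ->
  integrableR mu (fun x => ((u - x) ^+ 2 + y ^+ 2)^-1).
Proof.
move=> y0; apply: (@integrableR_bounded _ _ (y ^- 2)).
  exact: measurable_inv_sqr_dist.
move=> x; rewrite ger0_norm ?invr_ge0 ?(ltW (sqr_dist_gt0 _ _))//.
by rewrite lef_pV2 ?posrE ?sqr_dist_gt0 ?exprn_gt0// lerDr sqr_ge0.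
Qed.

Lemma integrableC_resolvent z : 0 < Im z -> integrableC mu (fun x => (z - x%:C)^-1).
Proof.
move=> z0; apply: (@integrableC_le _ _ (fun=> (Im z)^-1)).
- exact: measurableC_resolvent.
- by move=> x; exact: normc_resolvent.
- exact: integrableR_cst.
Qed.

Lemma Im_cauchy_transform z : 0 < Im z ->
  - Im (G z) = Im z * \int[mu]_x ((Re z - x) ^+ 2 + Im z ^+ 2)^-1.
Proof.
move=> z0; have [_ ii] := integrableC_resolvent z0.
rewrite -RintZ; last exact: integrableR_inv_sqr_dist.
rewrite -[LHS]mulN1r [Im _]/(\int[mu]_x Im (z - x%:C)^-1) -RintZ//.
by apply: eq_Rintegral => x _; rewrite Im_resolvent; ring.
Qed.

Lemma Im_cauchy_transform_lt0 z : 0 < Im z -> Im (G z) < 0.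
Proof.
move=> z0; rewrite -oppr_gt0 Im_cauchy_transform// mulr_gt0//.
apply: Rint_gt0; first exact: integrableR_inv_sqr_dist.
by move=> x; rewrite invr_gt0 sqr_dist_gt0.
Qed.

Lemma cauchy_transform_neq0 z : 0 < Im z -> G z != 0.
Proof.
move=> /Im_cauchy_transform_lt0 h; apply/eqP => G0; move: h.
by rewrite G0 ltxx.
Qed.

(** Jensen's inequality for the resolvent 1 / (z - x). *)
Lemma normc_cauchy_transform_sqr z : 0 < Im z ->
  normc (G z) ^+ 2 <= \int[mu]_x ((Re z - x) ^+ 2 + Im z ^+ 2)^-1.
Proof.
move=> z0; have [ir ii] := integrableC_resolvent z0.
have ci := integrableR_inv_sqr_dist (Re z) z0.
have [mr mi] := measurableC_resolvent z0.
have nE x : Re (z - x%:C)^-1 ^+ 2 + Im (z - x%:C)^-1 ^+ 2 =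
            ((Re z - x) ^+ 2 + Im z ^+ 2)^-1.
  by rewrite -normc_sqrE normcV exprVn normc_sqrE Re_subr Im_subr.
have r2 : integrableR mu (fun x => Re (z - x%:C)^-1 ^+ 2).
  apply: integrableR_le ci; first exact: measurable_funX.
  by move=> x; rewrite -nE ger0_norm ?sqr_ge0// lerDl sqr_ge0.
have i2 : integrableR mu (fun x => Im (z - x%:C)^-1 ^+ 2).
  apply: integrableR_le ci; first exact: measurable_funX.
  by move=> x; rewrite -nE ger0_norm ?sqr_ge0// lerDr sqr_ge0.
under eq_Rintegral do rewrite -nE.
by rewrite RintD// normc_sqrE lerD// Rint_sqr_le.
Qed.

Lemma Im_reciprocal_cauchy z : Im (F z) = - Im (G z) / normc (G z) ^+ 2.
Proof. by rewrite cImV. Qed.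

(** Since - Im G is Im z times the mean of 1 / |z - x|^2, this is Jensen's
    inequality for the resolvent. It keeps every orbit of F at least as high as
    its starting point, so estimates valid above a given height apply along the
    whole orbit. *)
Lemma Im_reciprocal_cauchy_ge z : 0 < Im z -> Im z <= Im (F z).
Proof.
move=> z0; rewrite Im_reciprocal_cauchy ler_pdivlMr.
  by rewrite Im_cauchy_transform// ler_pM2l// normc_cauchy_transform_sqr.
by rewrite exprn_gt0// normc_gt0 cauchy_transform_neq0.
Qed.

Lemma Im_iter_ge k z : 0 < Im z -> Im z <= Im (iter k F z).
Proof.
move=> z0; elim: k => //= k ih; apply: (le_trans ih).
by apply: Im_reciprocal_cauchy_ge; exact: lt_le_trans ih.
Qed.

Lemma Im_iter_gt0 k z : 0 < Im z -> 0 < Im (iter k F z).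
Proof. by move=> z0; apply: (lt_le_trans z0); exact: Im_iter_ge. Qed.

End half_plane.

(** Monotone convolution powers become iterates of a single map. *)
Lemma monotone_pow_iter {R : realType} (nu mu : borel_probability R) N (z : R[i]) :
  is_monotone_pow nu N mu -> 0 < complex.Im z ->
  reciprocal_cauchy mu z = iter N (reciprocal_cauchy nu) z.
Proof.
move=> h; elim: h z => // {mu}n rho mu _ ih conv z z0.
rewrite conv// ih ?iterSr// (lt_le_trans z0)//; exact: Im_reciprocal_cauchy_ge.
Qed.

(** * Finiteness of the variance of a monotone convolution root *)

Lemma cvg_sqr {R : realType} (f : nat -> R) (a : R) :
  f n @[n --> \oo] --> a -> f n ^+ 2 @[n --> \oo] --> a ^+ 2.
Proof. by move=> fa; rewrite expr2; under eq_fun do rewrite expr2; exact: cvgM. Qed.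

Section second_moment.
Context {R : realType}.
Variable mu : borel_probability R.
Notation Re := complex.Re.
Notation Im := complex.Im.
Notation G := (cauchy_transform mu).
Notation F := (reciprocal_cauchy mu).

Let w (y x : R) := ((0 - x) ^+ 2 + y ^+ 2)^-1.

Let w_gt0 y x : 0 < y -> 0 < w y x.
Proof. by move=> y0; rewrite invr_gt0 sqr_dist_gt0. Qed.

Let w_mul y x : 0 < y -> w y x * (x ^+ 2 + y ^+ 2) = 1.
Proof. by move=> y0; rewrite /w sub0r sqrrN mulVf// gt_eqF// sqr_dist_gt0. Qed.

Let w_meas y : 0 < y -> measurable_fun [set: R] (w y).
Proof. by move=> y0; exact: measurable_inv_sqr_dist. Qed.

(** A truncation of the identity, bounded by y and tending to x as y grows. It
    is - y^2 times the real part of 1 / (iy - x). *)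
Let X (y x : R) := y ^+ 2 * (x * w y x).

Let X_meas y : 0 < y -> measurable_fun [set: R] (X y).
Proof.
move=> y0; apply: measurable_funM; first exact: measurable_cst.
by apply: measurable_funM; [exact: measurable_id|exact: w_meas].
Qed.

Let X_le y x : 0 < y -> `|X y x| <= y.
Proof.
move=> y0; have w0 := w_gt0 x y0; have wm := w_mul x y0.
rewrite /X normrM [in X in _ * X]normrM (gtr0_norm w0) (ger0_norm (sqr_ge0 y)).
have h : y * (`|x| * w y x) <= 1.
  rewrite -wm mulrA mulrC ler_pM2l// -[x ^+ 2]real_normK ?num_real//.
  by have := sqr_ge0 (`|x| - y); have := sqr_ge0 `|x|; nra.
by rewrite expr2 -mulrA ler_piMr// ltW.
Qed.

Let X_sqr_le y x : 0 < y -> X y x ^+ 2 <= x ^+ 2.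
Proof.
move=> y0; have w0 := w_gt0 x y0; have wm := w_mul x y0.
have h : y ^+ 2 * w y x <= 1 by rewrite -wm mulrC ler_pM2l// lerDr sqr_ge0.
rewrite /X mulrCA exprMn ler_piMr ?sqr_ge0// exprn_ile1//.
by rewrite mulr_ge0 ?sqr_ge0// ltW.
Qed.

Let X_int y : 0 < y -> integrableR mu (X y).
Proof. by move=> y0; apply: (integrableR_bounded mu (X_meas y0)) => x; exact: X_le. Qed.

Let X2_int y : 0 < y -> integrableR mu (fun x => X y x ^+ 2).
Proof.
move=> y0; apply: (@integrableR_bounded _ _ (y ^+ 2)).
  by apply: measurable_funX; exact: X_meas.
by move=> x; rewrite normrX ler_pXn2r ?nnegrE ?(ltW y0)// X_le.
Qed.

(** The hypothesis bounds the variance of 1 / (iy - x) by C / y^4, and y^4 times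
    this variance dominates the variance of X. *)
Let X_variance y C : 0 < y -> 0 <= C -> Im (F (0 +i* y)) <= y + C / y ->
  \int[mu]_x (X y x ^+ 2) <= (\int[mu]_x X y x) ^+ 2 + C.
Proof.
move=> y0 C0 FC; set z : R[i] := 0 +i* y.
have z0 : 0 < Im z by [].
set A := \int[mu]_x w y x.
have wi : integrableR mu (w y) by exact: integrableR_inv_sqr_dist.
have w2i : integrableR mu (fun x => w y x ^+ 2).
  apply: (@integrableR_bounded _ _ ((y ^- 2) ^+ 2)); first by apply: measurable_funX; exact: w_meas.
  move=> x; rewrite normrX ler_pXn2r ?nnegrE ?invr_ge0 ?exprn_ge0 ?(ltW y0)//.
  rewrite gtr0_norm ?w_gt0// lef_pV2 ?posrE ?sqr_dist_gt0 ?exprn_gt0//.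
  by rewrite lerDr sqr_ge0.
have ReG : Re (G z) = - y ^- 2 * \int[mu]_x X y x.
  rewrite -RintZ; last exact: X_int.
  apply: eq_Rintegral => x _; rewrite Re_resolvent/= /X /w mulrA mulNr mulVf ?mulN1r.
    by rewrite sub0r mulNr.
  by rewrite gt_eqF ?exprn_gt0.
have ImG : - Im (G z) = y * A by rewrite Im_cauchy_transform.
set n2 := normc (G z) ^+ 2.
have n2E : n2 = (y ^- 2) ^+ 2 * (\int[mu]_x X y x) ^+ 2 + (y * A) ^+ 2.
  by rewrite /n2 normc_sqrE -[in X in _ + X]sqrrN ImG ReG exprMn sqrrN.
have n20 : 0 < n2 by rewrite exprn_gt0// normc_gt0 cauchy_transform_neq0.
have AJ : A ^+ 2 <= \int[mu]_x (w y x ^+ 2) by exact: Rint_sqr_le.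
have n2A : n2 <= A by exact: normc_cauchy_transform_sqr.
have Ay : A <= y ^- 2.
  rewrite -[leRHS](@Rint_cst _ mu); apply: Rint_le => //; first exact: integrableR_cst.
  by move=> x; rewrite lef_pV2 ?posrE ?sqr_dist_gt0 ?exprn_gt0// lerDr sqr_ge0.
have key : A <= n2 + C * (y ^- 2) ^+ 2.
  move: FC; rewrite Im_reciprocal_cauchy ImG ler_pdivrMr// => h.
  have {}h : A <= (1 + C * y ^- 2) * n2.
    rewrite -(ler_pM2l y0) (le_trans h)// le_eqVlt; apply/orP; left; apply/eqP.
    by rewrite -/n2; field; rewrite gt_eqF.
  apply: (le_trans h); rewrite mulrDl mul1r lerD2l -[X in _ <= C * X]/(y ^- 2 * y ^- 2) [leRHS]mulrA.
  rewrite ler_wpM2l//; first by rewrite mulr_ge0// invr_ge0 exprn_ge0 ?(ltW y0).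
  exact: le_trans n2A Ay.
(* x^2 w^2 = w - y^2 w^2, the identity behind Re^2 = |.|^2 - Im^2. *)
have XE x : X y x ^+ 2 = y ^+ 4 * (w y x - y ^+ 2 * w y x ^+ 2).
  have wm := w_mul x y0.
  have -> : w y x - y ^+ 2 * w y x ^+ 2 = w y x * (w y x * (x ^+ 2 + y ^+ 2)) - y ^+ 2 * w y x ^+ 2.
    by rewrite wm mulr1.
  by rewrite /X; ring.
under eq_Rintegral do rewrite XE.
rewrite RintZ; last by apply: integrableRB => //; exact: integrableRZ.
rewrite RintB//; last exact: integrableRZ.
rewrite RintZ// -/A.
have y4 : y ^+ 4 * (y ^- 2) ^+ 2 = 1.
  by rewrite -exprVn -exprM -exprMn divff ?expr1n// gt_eqF.
set m := \int[mu]_x X y x in n2E *.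
have : y ^+ 4 * A <= y ^+ 4 * (n2 + C * (y ^- 2) ^+ 2).
  by rewrite ler_pM2l// exprn_gt0.
have : y ^+ 4 * (y ^+ 2 * A ^+ 2) <= y ^+ 4 * (y ^+ 2 * \int[mu]_x (w y x ^+ 2)).
  by rewrite ler_pM2l ?exprn_gt0// ler_pM2l ?exprn_gt0.
rewrite n2E; move: (\int[mu]_x _) => I2 h1.
have -> : y ^+ 4 * ((y ^- 2) ^+ 2 * m ^+ 2 + (y * A) ^+ 2 + C * (y ^- 2) ^+ 2) =
  (y ^+ 4 * (y ^- 2) ^+ 2) * (m ^+ 2 + C) + y ^+ 4 * (y ^+ 2 * A ^+ 2) by ring.
rewrite y4; lra.
Qed.

(** Let m be the mean of X y and phi = 1 / (1 + x^2). As phi X^2 <= 1, the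
    weighted variance phi (X - m)^2 is at least phi m^2 / 2 - 1, so a bounded
    variance forces m to be bounded. Then X y is bounded in L^2, and Fatou's
    lemma bounds the second moment. *)
Lemma has_moment2_of_Im_reciprocal_cauchy C Y0 : 0 <= C -> 0 < Y0 ->
  (forall y, Y0 <= y -> Im (F (0 +i* y)) <= y + C / y) -> has_moment mu 2.
Proof.
move=> C0 Y00 FC.
pose phi := w 1; pose q := \int[mu]_x phi x.
have phii : integrableR mu phi by exact: integrableR_inv_sqr_dist.
have q0 : 0 < q by apply: Rint_gt0 => // x; exact: w_gt0.
have bnd y : Y0 <= y -> \int[mu]_x (X y x ^+ 2) <= C + 2 * (C + 1) / q.
  move=> Yy; have y0 := lt_le_trans Y00 Yy.
  have V := X_variance y0 C0 (FC _ Yy).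
  set m := \int[mu]_x X y x in V.
  have Vm : \int[mu]_x (X y x ^+ 2 - (2 * m) * X y x) <= C - m ^+ 2.
    have Xi := X_int y0; have X2i := X2_int y0.
    rewrite RintB ?(RintZ _ Xi)//; last exact: integrableRZ.
    by rewrite -/m; lra.
  have : \int[mu]_x (m ^+ 2 / 2 * phi x - (1 + m ^+ 2)) <= C - m ^+ 2.
    apply: le_trans Vm; apply: Rint_le.
    - by apply: integrableRB; [exact: integrableRZ|exact: integrableR_cst].
    - by apply: integrableRB; [exact: X2_int|apply: integrableRZ; exact: X_int].
    move=> x; have p0 := w_gt0 x (@ltr01 R); have pm := w_mul x (@ltr01 R).
    have Xx := X_sqr_le x y0; rewrite -/(phi x) expr1n in p0 pm.
    have p1 : phi x <= 1 by have := mulr_ge0 (ltW p0) (sqr_ge0 x); lra.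
    have pX : phi x * X y x ^+ 2 <= 1 by have := ler_wpM2l (ltW p0) Xx; lra.
    (* The two squares that add up to the weighted bound described above. *)
    have h1 : 0 <= (1 - phi x) * (X y x - m) ^+ 2 by rewrite mulr_ge0 ?sqr_ge0 ?subr_ge0.
    have h2 : 0 <= phi x * (2 * X y x - m) ^+ 2 by rewrite mulr_ge0 ?sqr_ge0 ?ltW.
    nra.
  rewrite RintB ?RintZ ?Rint_cst//; [|exact: integrableRZ|exact: integrableR_cst].
  rewrite -/q => h.
  have : m ^+ 2 <= 2 * (C + 1) / q by rewrite ler_pdivlMr//; lra.
  lra.
have [] // := @Fatou_cvg _ mu (fun n x => X n.+1%:R x ^+ 2) (fun x => x ^+ 2)
  (fun=> C + 2 * (C + 1) / q) (C + 2 * (C + 1) / q).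
- by move=> n; apply: measurable_funX; exact: X_meas.
- by move=> n x; exact: sqr_ge0.
- move=> x.
  have XE n : X n.+1%:R x = x * ((x * harmonic n) ^+ 2 + 1)^-1.
    rewrite /X /w sub0r sqrrN /harmonic/=; have : 0 < n.+1%:R :> R by rewrite ltr0n.
    move: (n.+1%:R : R) => y y0; field.
    by rewrite !gt_eqF// ?sqr_dist_gt0//; have := sqr_ge0 x; have := exprn_gt0 2 y0; lra.
  under eq_fun do rewrite XE.
  have -> : x ^+ 2 = (x * ((x * 0) ^+ 2 + 1)^-1) ^+ 2.
    by rewrite mulr0 expr0n/= add0r invr1 mulr1.
  apply: cvg_sqr.
  apply: cvgM; first exact: cvg_cst.
  apply: cvgV; first by rewrite mulr0 expr0n/= add0r oner_neq0.
  apply: cvgD; last exact: cvg_cst.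
  apply: cvg_sqr.
  by apply: cvgM; [exact: cvg_cst|exact: cvg_harmonic].
- near=> n; split; first by apply: X2_int; rewrite ltr0n.
  apply: bnd; rewrite (@le_trans _ _ n%:R)// ?ler_nat//; near: n; exact: nbhs_infty_ger.
- exact: cvg_cst.
Unshelve. all: by end_near. Qed.

End second_moment.

(** * The mean of a monotone convolution root *)

Section translation_asymptotics.
Context {R : realType}.
Variable mu : borel_probability R.
Implicit Types (z : R[i]).
Notation Re := complex.Re.
Notation Im := complex.Im.
Notation G := (cauchy_transform mu).
Notation F := (reciprocal_cauchy mu).
Notation K := (cauchy_pow mu).

Lemma Im_le_normc_gt z : 0 < Im z -> Im z <= normc z.
Proof. by move=> z0; rewrite (le_trans _ (Im_le_normc z))// ler_norm. Qed.

Lemma normc_gt0_Im z : 0 < Im z -> 0 < normc z.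
Proof. by move=> z0; rewrite (lt_le_trans z0)// Im_le_normc_gt. Qed.

Lemma mul_cauchy_transform z : 0 < Im z -> has_moment mu 1 -> z * G z = 1 + K 1 z.
Proof. by move=> z0 h1; rewrite cauchy_transformE cauchy_powS// moment0. Qed.

Lemma one_cauchy_pow_neq0 z : 0 < Im z -> has_moment mu 1 -> 1 + K 1 z != 0.
Proof.
move=> z0 h1; rewrite -mul_cauchy_transform// mulf_neq0// ?(Im_neq0 z0)//.
exact: cauchy_transform_neq0.
Qed.

Lemma reciprocal_cauchyE z : 0 < Im z -> has_moment mu 1 -> F z = z / (1 + K 1 z).
Proof.
move=> z0 h1; rewrite -mul_cauchy_transform// invfM mulrA divff ?mul1r//.
exact: Im_neq0.
Qed.

Lemma normc_one_add_ge (d : R[i]) : normc d <= 1 / 2 -> 1 / 2 <= normc (1 + d).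
Proof. by have := le_normc_sub 1 d; rewrite normc1; lra. Qed.

(** At great height F is, up to O(1 / Im z), the translation by minus the mean.
    The bound does not restrict Re z, so it can be iterated. *)
Lemma reciprocal_cauchy_shift : has_moment mu 2 -> exists C Y, [/\ 0 <= C, 0 < Y &
  forall z, Y <= Im z -> normc (F z - z + (moment mu 1)%:C) <= C / Im z].
Proof.
move=> h2; have h1 : has_moment mu 1 by exact: has_moment_le h2.
set a := moment mu 1; set m := `|a| + abs_moment mu 2.
have m2 := abs_moment_ge0 mu 2.
have a0 : 0 <= `|a| by [].
have m0 : 0 <= m by rewrite addr_ge0.
(* Above height 1 + 2 m one has |K 1 z| <= 1 / 2, which bounds 1 / (1 + K 1 z) by 2. *)
exists (2 * (`|a| * m + abs_moment mu 2)), (1 + 2 * m); split.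
- by rewrite mulr_ge0// addr_ge0// mulr_ge0.
- by rewrite ltr_pwDl// mulr_ge0.
move=> z zY.
have z1 : 1 <= Im z by rewrite (le_trans _ zY)// lerDl mulr_ge0.
have z0 : 0 < Im z by rewrite (lt_le_trans _ z1).
have K2 : normc (K 2 z) <= abs_moment mu 2 / Im z by exact: normc_cauchy_pow.
have zK1 : z * K 1 z = a%:C + K 2 z by exact: cauchy_powS.
have nz := Im_le_normc_gt z0; have nz0 := normc_gt0_Im z0.
have K1 : normc (K 1 z) <= m / Im z.
  rewrite ler_pdivlMr// mulrC (@le_trans _ _ (normc z * normc (K 1 z)))//.
    by rewrite ler_wpM2r// normc_ge0.
  rewrite -normcM zK1 (le_trans (normc_le_add _ _))// normc_real lerD2l.
  rewrite (le_trans K2)// ler_pdivrMr//; nra.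
have K1h : normc (K 1 z) <= 1 / 2.
  rewrite (le_trans K1)// ler_pdivrMr//; lra.
have := normc_one_add_ge K1h.
have D0 := one_cauchy_pow_neq0 z0 h1.
have -> : F z - z + a%:C = (a%:C * K 1 z - K 2 z) / (1 + K 1 z).
  have -> : K 2 z = z * K 1 z - a%:C by rewrite zK1 addrC addKr.
  by rewrite reciprocal_cauchyE//; field.
rewrite normcM normcV => h.
have h2' : (normc (1 + K 1 z))^-1 <= 2.
  rewrite -[leRHS]invrK lef_pV2 ?posrE ?invr_gt0//; lra.
have h3 : normc (a%:C * K 1 z - K 2 z) <= (`|a| * m + abs_moment mu 2) / Im z.
  rewrite (le_trans (normc_le_sub _ _))// mulrDl lerD// normcM normc_real.
  by rewrite -mulrA ler_wpM2l.
rewrite -mulrA mulrC ler_pM ?invr_ge0 ?normc_ge0//.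
Qed.

Lemma iter_reciprocal_cauchy_shift C Y : 0 <= C -> 0 < Y ->
  (forall z, Y <= Im z -> normc (F z - z + (moment mu 1)%:C) <= C / Im z) ->
  forall k z, Y <= Im z ->
    normc (iter k F z - z + (k%:R * moment mu 1)%:C) <= k%:R * C / Im z.
Proof.
move=> C0 Y0 FC; elim=> [|k ih] z zY.
  by rewrite /= subrr mul0r add0r normc_real normr0 !mul0r.
have z0 : 0 < Im z by exact: lt_le_trans zY.
have zk := Im_iter_ge mu k z0.
have -> : iter k.+1 F z - z + (k.+1%:R * moment mu 1)%:C =
  (F (iter k F z) - iter k F z + (moment mu 1)%:C) +
  (iter k F z - z + (k%:R * moment mu 1)%:C).
  by rewrite -natr1 mulrDl mul1r rmorphD/=; ring.
rewrite (le_trans (normc_le_add _ _))// -natr1 addrC mulrDl mul1r mulrDl lerD ?ih//.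
rewrite (le_trans (FC _ (le_trans zY zk)))// ler_wpM2l// lef_pV2 ?posrE//.
exact: lt_le_trans zk.
Qed.

End translation_asymptotics.

Section root_moments.
Context {R : realType}.
Variables (nu mu : borel_probability R) (N : nat).
Hypothesis N0 : (0 < N)%N.
Hypothesis nuN : is_monotone_pow nu N mu.
Hypothesis mu2 : has_moment mu 2.
Hypothesis mu1 : moment mu 1 = 0.
Implicit Types (z : R[i]).
Notation Re := complex.Re.
Notation Im := complex.Im.

(** No step of the iteration lowers the imaginary part, so the total rise
    Im F_mu(iy) - y, which is O(1 / y), dominates the rise of the first step. *)
Lemma root_has_moment2 : has_moment nu 2.
Proof.
have [C [Y [C0 Y0 FC]]] := reciprocal_cauchy_shift mu2.
apply: (@has_moment2_of_Im_reciprocal_cauchy _ nu C Y) => // y yY.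
have y0 : 0 < y by exact: lt_le_trans yY.
have := FC (0 +i* y) yY; rewrite mu1 addr0 => h.
have : Im (reciprocal_cauchy mu (0 +i* y)) <= y + C / y.
  have := le_trans (Im_le_normc _) h; rewrite cImD cImN/= => /(le_trans (ler_norm _)).
  by rewrite lerBlDl.
apply: le_trans; rewrite (monotone_pow_iter nuN)//.
case: N N0 => // n _; rewrite iterSr; apply: Im_iter_ge.
by apply: lt_le_trans (Im_reciprocal_cauchy_ge nu _).
Qed.

(** Iterating N translations by - a moves iy by about - N a, whereas F_mu moves
    it by O(1 / y). *)
Lemma root_moment1 : moment nu 1 = 0.
Proof.
have [C [Y [C0 Y0 FC]]] := reciprocal_cauchy_shift mu2.
have [C' [Y' [C'0 Y'0 FC']]] := reciprocal_cauchy_shift root_has_moment2.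
have it := iter_reciprocal_cauchy_shift C'0 Y'0 FC'.
set a := moment nu 1.
have bnd y : Y <= y -> Y' <= y -> `|a| * y <= C + N%:R * C'.
  move=> yY yY'; have y0 : 0 < y by exact: lt_le_trans yY.
  have := FC (0 +i* y) yY; rewrite mu1 addr0 (monotone_pow_iter nuN)// => h1.
  have h2 := it N (0 +i* y) yY'.
  have : normc (N%:R * a)%:C <= (C + N%:R * C') / y.
    set z := 0 +i* y in h1 h2 *; set w := iter _ _ _ in h1 h2.
    have -> : (N%:R * a)%:C = (w - z + (N%:R * a)%:C) - (w - z) by ring.
    by rewrite (le_trans (normc_le_sub _ _))// addrC mulrDl lerD.
  rewrite normc_real ler_pdivlMr// normrM normr_nat; apply: le_trans.
  by rewrite ler_pM2r// ler_peMl// ler1n.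
apply/eqP; rewrite -normr_eq0 eq_le normr_ge0 andbT leNgt; apply/negP => a0.
have B0 : 0 <= C + N%:R * C' by rewrite addr_ge0// mulr_ge0.
set B := C + _ in bnd B0.
set y := Y + Y' + (B + 1) / `|a|.
have B10 : 0 < (B + 1) / `|a| by rewrite divr_gt0//; lra.
have := bnd y; rewrite {1 2}/y => /(_ _ _).
have yB : B + 1 <= `|a| * y by rewrite /y mulrDr (mulrC _ (_ / _)) divfK ?gt_eqF// lerDr mulr_ge0//; lra.
by move=> h; have := h ltac:(lra) ltac:(lra); lra.
Qed.

End root_moments.

(** * The square of the reciprocal Cauchy transform of a centred measure *)

Section centered.
Context {R : realType}.
Variable mu : borel_probability R.
Hypothesis mu2 : has_moment mu 2.
Hypothesis mu1 : moment mu 1 = 0.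
Implicit Types (z : R[i]).
Notation Re := complex.Re.
Notation Im := complex.Im.
Notation F := (reciprocal_cauchy mu).
Notation K := (cauchy_pow mu).
Notation s := (moment mu 2).

Let mu1' : has_moment mu 1. Proof. exact: has_moment_le mu2. Qed.

Lemma moment2_ge0 : 0 <= s.
Proof. by apply: Rint_ge0 => x; exact: sqr_ge0. Qed.

(** z^2 (z G(z) - 1) for a centred measure: it tends to the variance, and
    F^2 = z^2 - 2 kappa to leading order. *)
Definition kappa z : R[i] := z * K 2 z.

(** The real part of (variance - kappa). It is written with the factor
    x (x - Re z), nonnegative up to Re(z)^2 / 4, since this sign makes Fatou's
    lemma applicable to fourth moments. *)
Definition defect z : R :=
  \int[mu]_x (x ^+ 2 * (x * (x - Re z)) * ((Re z - x) ^+ 2 + Im z ^+ 2)^-1).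

Lemma sqr_mul_cauchy_pow1 z : 0 < Im z -> z ^+ 2 * K 1 z = kappa z.
Proof.
by move=> z0; rewrite expr2 -mulrA (cauchy_powS z0 mu2) mu1 add0r.
Qed.

Lemma normc_kappa_le z : 0 < Im z -> normc (kappa z) / normc z <= s / Im z.
Proof.
move=> z0; have nz := normc_gt0_Im z0.
rewrite /kappa normcM mulrC mulKf ?gt_eqF// -abs_moment_even//.
exact: normc_cauchy_pow.
Qed.

Lemma normc_cauchy_pow1_le z : 0 < Im z -> normc (K 1 z) <= s / Im z ^+ 2.
Proof.
move=> z0; have nz := normc_gt0_Im z0; have nI := Im_le_normc_gt z0.
have -> : K 1 z = K 2 z / z.
  by apply: (mulfI (Im_neq0 z0)); rewrite (cauchy_powS z0 mu2) mu1 add0r mulrC divfK ?Im_neq0.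
rewrite normcM normcV expr2 invfM mulrA ler_pM ?invr_ge0 ?normc_ge0//.
  by rewrite -abs_moment_even// normc_cauchy_pow.
by rewrite lef_pV2 ?posrE.
Qed.

(** F = z / (1 + K) with K = kappa / z^2, and
    1 / (1 + K)^2 = 1 - 2 K + K^2 (3 + 2 K) / (1 + K)^2. *)
Lemma reciprocal_cauchy_sqrE z : 0 < Im z ->
  F z ^+ 2 - z ^+ 2 + 2 * kappa z =
  kappa z * K 1 z * (3 + 2 * K 1 z) / (1 + K 1 z) ^+ 2.
Proof.
move=> z0; have D0 := one_cauchy_pow_neq0 z0 mu1'.
by rewrite -sqr_mul_cauchy_pow1// reciprocal_cauchyE//; field.
Qed.

Lemma normc_inv_le z : 0 < Im z -> normc (K 1 z) <= 1 / 2 ->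
  normc ((1 + K 1 z) ^- 2) <= 4.
Proof.
move=> z0 /normc_one_add_ge h; rewrite normcV normcXn.
rewrite -[leRHS]invrK lef_pV2 ?posrE ?invr_gt0//; last by rewrite exprn_gt0//; lra.
by rewrite (_ : 4^-1 = (1 / 2) ^+ 2) ?ler_pXn2r ?nnegrE ?normc_ge0//; field.
Qed.

Lemma normc_natr (n : nat) : normc (n%:R : R[i]) = n%:R :> R.
Proof. by rewrite -(rmorph_nat (real_complex R)) normc_real normr_nat. Qed.

(** To leading order F^2 is z^2 - 2 s. The increment does not depend on z, so
    squaring turns the iteration of F into a telescoping sum. *)
Lemma reciprocal_cauchy_sqr_approx z : 0 < Im z -> normc (K 1 z) <= 1 / 2 ->
  normc (F z ^+ 2 - z ^+ 2 + 2 * kappa z) <= 16 * (normc (kappa z) / normc z) ^+ 2.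
Proof.
move=> z0 Kh; have nz := normc_gt0_Im z0.
rewrite reciprocal_cauchy_sqrE// normcM normcM normcM.
have -> : (normc (kappa z) / normc z) ^+ 2 = normc (kappa z) * normc (K 1 z).
  have -> : normc (kappa z) = normc z ^+ 2 * normc (K 1 z).
    by rewrite -(sqr_mul_cauchy_pow1 z0) normcM normcXn.
  by field; rewrite gt_eqF.
set a := normc (kappa z) * _; have a0 : 0 <= a by rewrite mulr_ge0 ?normc_ge0.
have -> : 16 * a = a * 4 * 4 by ring.
rewrite ler_pM ?normc_ge0 ?mulr_ge0 ?normc_ge0 ?normc_inv_le//.
rewrite ler_wpM2l// (le_trans (normc_le_add _ _))// normcM !normc_natr; lra.
Qed.

Lemma Re_mul_pow_resolvent z x : 0 < Im z ->
  x ^+ 2 * (x * (x - Re z)) * ((Re z - x) ^+ 2 + Im z ^+ 2)^-1 =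
  x ^+ 2 - Re (z * ((x ^+ 2)%:C * (z - x%:C)^-1)).
Proof.
move=> z0; have d0 := sqr_dist_gt0 (Re z - x) z0.
rewrite cReM cReM cImM Re_resolvent Im_resolvent /=; field.
by rewrite gt_eqF.
Qed.

Lemma integrableR_defect z : 0 < Im z ->
  integrableR mu (fun x => x ^+ 2 * (x * (x - Re z)) * ((Re z - x) ^+ 2 + Im z ^+ 2)^-1).
Proof.
move=> z0; under eq_fun do rewrite Re_mul_pow_resolvent//.
apply: integrableRB => //.
have [ir ii] := integrableC_pow_resolvent z0 mu2.
by under eq_fun do rewrite cReM; apply: integrableRB; exact: integrableRZ.
Qed.

Lemma Re_kappa z : 0 < Im z -> Re (kappa z) = s - defect z.
Proof.
move=> z0; have ci := integrableC_pow_resolvent z0 mu2; have [ir ii] := ci.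
rewrite /defect; under eq_Rintegral do rewrite Re_mul_pow_resolvent//.
rewrite RintB//; last by under eq_fun do rewrite cReM; apply: integrableRB; exact: integrableRZ.
by rewrite opprB addrCA subrr addr0 /kappa /cauchy_pow -integralCZ.
Qed.

Lemma defect_le z x : `|Re z| <= Im z -> 0 < Im z ->
  `|x ^+ 2 * (x * (x - Re z)) * ((Re z - x) ^+ 2 + Im z ^+ 2)^-1| <= 2 * x ^+ 2.
Proof.
move=> uy z0; have d0 := sqr_dist_gt0 (Re z - x) z0.
rewrite normrM normrM (ger0_norm (sqr_ge0 x)) [X in _ * X]gtr0_norm ?invr_gt0//.
rewrite normrM [leRHS]mulrC -mulrA ler_wpM2l ?sqr_ge0// ler_pdivrMr//.
have -> : (Re z - x) ^+ 2 = `|x - Re z| ^+ 2 by rewrite real_normK ?num_real// -sqrrN opprB.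
have h : `|x| <= `|x - Re z| + Im z.
  by rewrite -{1}(subrK (Re z) x) (le_trans (ler_normD _ _))// lerD2l.
have n0 := normr_ge0 (x - Re z); move: `|x - Re z| n0 h => n n0 h.
have : `|x| * n <= (n + Im z) * n by rewrite ler_wpM2r.
by have := sqr_ge0 (n - Im z); nra.
Qed.

(** Dominated convergence: the integrand is at most 2 x^2 by [defect_le]. *)
Lemma defect_cvg0 (z : nat -> R[i]) :
  (forall j, j.+1%:R <= Im (z j)) -> (forall j, `|Re (z j)| <= 1) ->
  defect (z j) @[j --> \oo] --> (0 : R).
Proof.
move=> zI zR.
have zI1 j : 1 <= Im (z j) by rewrite (le_trans _ (zI j))// ler1n.
have zI0 j : 0 < Im (z j) by rewrite (lt_le_trans _ (zI1 j)).
rewrite -(@Rint_cst _ mu 0).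
apply: (@dominated_cvg_Rint _ mu _ _ (fun x => 2 * x ^+ 2)).
- by move=> j; apply: integrableR_meas; exact: integrableR_defect.
- exact: measurable_cst.
- move=> x; apply/norm_cvg0P.
  apply: (@squeeze_cvgr _ _ _ _ (fun=> 0) (fun j => `|x| ^+ 3 * (`|x| + 1) * harmonic j)).
  + near=> j; rewrite normr_ge0/= normrM normrM.
    have d0 := sqr_dist_gt0 (Re (z j) - x) (zI0 j).
    rewrite [X in _ * X]gtr0_norm ?invr_gt0// normrX. rewrite normrM mulrA -exprSr. rewrite ler_pM ?mulr_ge0 ?invr_ge0 ?exprn_ge0 ?(ltW d0)//.
      rewrite ler_wpM2l ?exprn_ge0// (le_trans (ler_normD _ _))// lerD2l normrN.
      exact: zR.
    rewrite /harmonic/= lef_pV2 ?posrE//.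
    rewrite (@le_trans _ _ (Im (z j) ^+ 2))// ?lerDr ?sqr_ge0//.
    rewrite (le_trans (zI j))// expr2 ler_peMr// ltW//.
  + exact: cvg_cst.
  + by rewrite -[X in _ --> X](mulr0 (`|x| ^+ 3 * (`|x| + 1))); apply: cvgM; [exact: cvg_cst|exact: cvg_harmonic].
- by apply: integrableRZ.
- by move=> j x; apply: defect_le => //; rewrite (le_trans (zR j)).
Unshelve. all: by end_near. Qed.

End centered.

Section increments.
Context {R : realType}.
Variable mu : borel_probability R.
Hypothesis mu2 : has_moment mu 2.
Hypothesis mu1 : moment mu 1 = 0.
Implicit Types (z : R[i]).
Notation Re := complex.Re.
Notation Im := complex.Im.
Notation F := (reciprocal_cauchy mu).
Notation K := (cauchy_pow mu).
Notation s := (moment mu 2).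

Lemma normc_cauchy_pow1_half z : 1 + 2 * s <= Im z -> normc (K 1 z) <= 1 / 2.
Proof.
move=> h; have s0 := moment2_ge0 mu.
have z0 : 0 < Im z by lra.
rewrite (le_trans (normc_cauchy_pow1_le mu2 mu1 z0))// ler_pdivrMr ?exprn_gt0//; nra.
Qed.

Lemma Re_sqr_increment z : 1 + 2 * s <= Im z ->
  `|Re (F z ^+ 2 - z ^+ 2) + 2 * (s - defect mu z)| <= 16 * (s / Im z) ^+ 2.
Proof.
move=> h; have s0 := moment2_ge0 mu.
have z0 : 0 < Im z by lra.
have Kh := normc_cauchy_pow1_half h.
rewrite -(Re_kappa mu2 z0).
have -> : Re (F z ^+ 2 - z ^+ 2) + 2 * Re (kappa mu z) =
          Re (F z ^+ 2 - z ^+ 2 + 2 * kappa mu z).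
  by rewrite [in RHS]cReD cRe_natM.
rewrite (le_trans (Re_le_normc _))// (le_trans (reciprocal_cauchy_sqr_approx mu2 mu1 z0 Kh))//.
rewrite ler_wpM2l// ler_pXn2r ?nnegrE ?divr_ge0 ?normc_ge0 ?(ltW z0)//.
exact: normc_kappa_le.
Qed.

Lemma Re_sqr_increment_cvg (z : nat -> R[i]) :
  (forall j, j.+1%:R <= Im (z j)) -> (forall j, `|Re (z j)| <= 1) ->
  Re (F (z j) ^+ 2 - (z j) ^+ 2) @[j --> \oo] --> - 2 * s.
Proof.
move=> zI zR; have s0 := moment2_ge0 mu.
have d0 := defect_cvg0 mu2 zI zR.
have h0 : harmonic n @[n --> \oo] --> (0 : R) by exact: cvg_harmonic.
apply/subr_cvg0/norm_cvg0P.
apply: (@squeeze_cvgr _ _ _ _ (fun=> 0)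
   (fun j => 16 * (s * harmonic j) ^+ 2 + 2 * `|defect mu (z j)|)).
- near=> j; rewrite normr_ge0/=.
  have zj : 1 + 2 * s <= Im (z j).
    rewrite (le_trans _ (zI j))// (@le_trans _ _ j%:R) ?ler_nat//.
    by near: j; exact: nbhs_infty_ger.
  have := Re_sqr_increment zj; set r := Re _ => h.
  have zp : 0 < Im (z j) by lra.
  have h2 : 16 * (s / Im (z j)) ^+ 2 <= 16 * (s * harmonic j) ^+ 2.
    rewrite ler_wpM2l// ler_pXn2r ?nnegrE ?mulr_ge0 ?invr_ge0 ?(ltW zp)//.
    by rewrite ler_wpM2l// lef_pV2 ?posrE.
  have -> : r - - 2 * s = r + 2 * (s - defect mu (z j)) + 2 * defect mu (z j) by ring.
  rewrite (le_trans (ler_normD _ _))// lerD//; first exact: le_trans h h2.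
  by rewrite normrM ger0_norm.
- exact: cvg_cst.
- rewrite -[X in _ --> X]addr0; apply: cvgD.
    rewrite -[X in _ --> X](mulr0 16) -[X in 16 * X](expr0n R 2) -[in X in _ --> X](mulr0 s).
    by apply: cvgM; [exact: cvg_cst|apply: cvg_sqr; apply: cvgM; [exact: cvg_cst|]].
  rewrite -[X in _ --> X](mulr0 2); apply: cvgM; first exact: cvg_cst.
  by apply/norm_cvg0P.
Unshelve. all: by end_near. Qed.

(** The next term of the expansion of F^2 - z^2. On the imaginary axis
    y^2 defect is at most the fourth moment, and the quadratic correction
    kappa K (3 + 2 K) / (1 + K)^2 is 3 s^2 / z^2 = - 3 s^2 / y^2 to leading
    order. *)
Lemma Re_sqr_increment_fourth : has_moment mu 4 -> exists C, forall y, 1 + 2 * s <= y ->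
  y ^+ 2 * (Re (F (0 +i* y) ^+ 2 - (0 +i* y) ^+ 2) + 2 * s) <=
  2 * moment mu 4 - 3 * s ^+ 2 + C / y.
Proof.
move=> mu4; have s0 := moment2_ge0 mu.
have mu3 : has_moment mu 3 by exact: has_moment_le mu4.
have a3 := abs_moment_ge0 mu 3.
exists (22 * s ^+ 3 + 6 * abs_moment mu 3 * s) => y sy.
set z : R[i] := 0 +i* y.
have y0 : 0 < y by lra.
have z0 : 0 < Im z by [].
have Kh := normc_cauchy_pow1_half (sy : 1 + 2 * s <= Im z).
have nz : normc z = y by rewrite /= expr0n/= add0r sqrtr_sqr gtr0_norm.
have zz : z ^+ 2 = - (y ^+ 2)%:C.
  by rewrite expr2; apply: complex_eq; rewrite ?(cReM, cImM)/= ?oppr0; ring.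
have Rek := Re_kappa mu2 z0.
have kE := sqr_mul_cauchy_pow1 mu2 mu1 z0.
have eE := reciprocal_cauchy_sqrE mu2 mu1 z0.
have nk : normc (kappa mu z) <= s.
  have := normc_kappa_le mu2 z0; rewrite nz ler_pdivrMr// divfK//.
  by rewrite gt_eqF.
have nK1 := normc_cauchy_pow1_le mu2 mu1 z0.
have D4 : y ^+ 2 * defect mu z <= moment mu 4.
  rewrite -RintZ; last exact: integrableR_defect.
  apply: Rint_le => //; first by apply: integrableRZ; exact: integrableR_defect.
  move=> x /=; rewrite subr0 sub0r sqrrN.
  have d0 : 0 < x ^+ 2 + y ^+ 2 by exact: sqr_dist_gt0.
  rewrite mulrA ler_pdivrMr//.
  have -> : x ^+ 4 * (x ^+ 2 + y ^+ 2) = x ^+ 2 * x ^+ 4 + y ^+ 2 * (x ^+ 2 * (x * x)) by ring.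
  by rewrite lerDr mulr_ge0 ?sqr_ge0// exprn_even_ge0.
have k3 : kappa mu z = s%:C + K 3 z by exact: cauchy_powS.
have nK3 : normc (K 3 z) <= abs_moment mu 3 / y by exact: normc_cauchy_pow.
have KD0 := one_cauchy_pow_neq0 z0 (has_moment_le (isT : (1 <= 2)%N) mu2).
(* Isolates 3 s^2 / z^2; the bracket on the right is O(1 / y). *)
have E : F z ^+ 2 - z ^+ 2 + 2 * kappa mu z - z ^- 2 * (3 * s%:C ^+ 2) =
   z ^- 2 * (kappa mu z ^+ 2 * K 1 z * (- (4 + 3 * K 1 z)) / (1 + K 1 z) ^+ 2 +
     3 * (K 3 z * (kappa mu z + s%:C))).
  rewrite eE; have -> : kappa mu z * K 1 z = z ^- 2 * kappa mu z ^+ 2.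
    rewrite [in RHS]expr2 -[X in _ = _ * (X * _)]kE mulrA mulKf ?mulf_neq0 ?expf_neq0 ?(Im_neq0 z0)//.
    by rewrite mulrC.
  have -> : K 3 z = kappa mu z - s%:C by rewrite k3 addrC addKr.
  have zn := Im_neq0 z0.
  by field; rewrite KD0 zn.
have zV : z ^- 2 = - (y ^- 2)%:C.
  by rewrite zz invrN fmorphV.
have b1 : normc (kappa mu z ^+ 2 * K 1 z * (- (4 + 3 * K 1 z)) / (1 + K 1 z) ^+ 2) <=
   22 * s ^+ 3 / y.
  rewrite normcM normcM normcM normcXn.
  have i4 : normc ((1 + K 1 z) ^- 2) <= 4 by exact: normc_inv_le.
  have h11 : normc (- (4 + 3 * K 1 z)) <= 11 / 2.
    rewrite normc_Neg (le_trans (normc_le_add _ _))// normcM !normc_natr; lra.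
  have hK : normc (K 1 z) <= s / y.
    rewrite (le_trans nK1)// ler_wpM2l// lef_pV2 ?posrE ?exprn_gt0//= expr2 ler_peMr//; lra.
  have -> : 22 * s ^+ 3 / y = s ^+ 2 * (s / y) * (11 / 2) * 4 by field; rewrite gt_eqF.
  have k2 : normc (kappa mu z) ^+ 2 <= s ^+ 2 by rewrite ler_pXn2r ?nnegrE ?normc_ge0.
  by rewrite !ler_pM ?mulr_ge0 ?normc_ge0 ?exprn_ge0 ?normc_ge0.
have b2 : normc (3 * (K 3 z * (kappa mu z + s%:C))) <= 6 * abs_moment mu 3 * s / y.
  rewrite normcM normcM normc_natr.
  have -> : 6 * abs_moment mu 3 * s / y = 3 * (abs_moment mu 3 / y * (2 * s)).
    by field; rewrite gt_eqF.
  rewrite ler_wpM2l// ler_pM ?normc_ge0// (le_trans (normc_le_add _ _))//.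
  rewrite normc_real (ger0_norm s0); lra.
set e := _ + 3 * (K 3 z * _) in E.
have ne : `|Re e| <= (22 * s ^+ 3 + 6 * abs_moment mu 3 * s) / y.
  rewrite (le_trans (Re_le_normc _))// (le_trans (normc_le_add _ _))// [leRHS]mulrDl lerD//.
have := congr1 (@complex.Re R) E.
rewrite zV cReD cReN cReD cRe_natM Rek.
have -> : Re (- (y ^- 2)%:C * (3 * s%:C ^+ 2)) = - (3 * s ^+ 2) * y ^- 2.
  by rewrite -rmorphN cRe_realM cRe_natM -rmorphXn/=; ring.
have -> : Re (- (y ^- 2)%:C * e) = - Re e * y ^- 2.
  by rewrite -rmorphN cRe_realM; ring.
move=> EE.
have -> : y ^+ 2 * (Re (F z ^+ 2 - z ^+ 2) + 2 * s) =
  2 * (y ^+ 2 * defect mu z) - 3 * s ^+ 2 - Re e.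
  move/eqP: EE; rewrite subr_eq => /eqP; move: (Re (F z ^+ 2 - z ^+ 2)) => r rE.
  have -> : r + 2 * s = 2 * defect mu z - Re e * y ^- 2 - 3 * s ^+ 2 * y ^- 2 by lra.
  by field; rewrite gt_eqF.
have : - Re e <= `|Re e| by rewrite -normrN ler_norm.
lra.
Qed.

End increments.

(** * Second and fourth moments of a monotone convolution root *)

Section telescoping.
Context {R : realType}.
Variable mu : borel_probability R.
Notation F := (reciprocal_cauchy mu).

Lemma iter_sqr_telescope n (z : R[i]) : iter n F z ^+ 2 - z ^+ 2 =
  \sum_(k < n) (F (iter k F z) ^+ 2 - iter k F z ^+ 2).
Proof.
elim: n => [|n ih]; first by rewrite big_ord0 subrr.
by rewrite big_ord_recr/= -ih; ring.
Qed.

End telescoping.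

Section root_fourth_moment.
Context {R : realType}.
Variables (nu mu : borel_probability R) (N : nat).
Hypothesis N0 : (0 < N)%N.
Hypothesis nuN : is_monotone_pow nu N mu.
Hypothesis mu2 : has_moment mu 2.
Hypothesis mu1 : moment mu 1 = 0.
Implicit Types (z : R[i]).
Notation Re := complex.Re.
Notation Im := complex.Im.
Notation F := (reciprocal_cauchy nu).

Let nu2 : has_moment nu 2. Proof. exact: (root_has_moment2 N0 nuN mu2 mu1). Qed.
Let nu1 : moment nu 1 = 0. Proof. exact: (root_moment1 N0 nuN mu2 mu1). Qed.

Let height J j : R := (j + J).+1%:R.

Let path J k j : R[i] := iter k F (0 +i* height J j).

Let height_gt0 J j : 0 < height J j. Proof. by rewrite ltr0n. Qed.

(** The orbits of F started at i y, for y = height J j, stay above y and within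
    C / y of their starting point. The offset J makes the estimates of this part
    valid for all j, not only for large j. *)
Lemma root_path : exists C J, [/\ 0 <= C,
  forall j, 1 + 2 * moment mu 2 <= height J j,
  forall j, 1 + 2 * moment nu 2 <= height J j &
  forall k j, (k <= N)%N -> [/\ height J j <= Im (path J k j),
    normc (path J k j - 0 +i* height J j) <= C / height J j & C <= height J j]].
Proof.
have [C [Y [C0 Y0 FC]]] := reciprocal_cauchy_shift nu2.
have it := iter_reciprocal_cauchy_shift C0 Y0 FC.
have smu := moment2_ge0 mu; have snu := moment2_ge0 nu.
have C'0 : 0 <= N%:R * C by rewrite mulr_ge0.
set b := 1 + 2 * moment mu 2 + 2 * moment nu 2 + Y + N%:R * C.
have b0 : 0 <= b by rewrite /b; lra.
exists (N%:R * C), (Num.bound b).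
have hb j : b <= height (Num.bound b) j.
  rewrite (@le_trans _ _ (Num.bound b)%:R)//.
    by rewrite ltW// archi_boundP.
  by rewrite ler_nat ltnW// ltnS leq_addl.
split => //.
- by move=> j; apply: le_trans (hb j); rewrite /b; lra.
- by move=> j; apply: le_trans (hb j); rewrite /b; lra.
move=> k j kN; have hj := hb j; have h0 := height_gt0 (Num.bound b) j; split.
- exact: (@Im_iter_ge _ nu k (0 +i* height _ j)).
- have := it k (0 +i* height (Num.bound b) j); rewrite nu1 mulr0 addr0 => /(_ _)/le_trans.
  apply; first by apply: le_trans hj; rewrite /b; lra.
  by rewrite ler_pM2r ?invr_gt0// ler_wpM2r// ler_nat.
- by apply: le_trans hj; rewrite /b; lra.
Qed.

Lemma sqr_increment_telescope J j :
  Re (reciprocal_cauchy mu (0 +i* height J j) ^+ 2 - (0 +i* height J j) ^+ 2) =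
  \sum_(k < N) Re (F (path J k j) ^+ 2 - path J k j ^+ 2).
Proof. by rewrite (monotone_pow_iter nuN)// iter_sqr_telescope cRe_sum. Qed.

Lemma cvg_sum_ord n (u : 'I_n -> nat -> R) (l : 'I_n -> R) :
  (forall i, u i j @[j --> \oo] --> l i) ->
  (\sum_(i < n) u i j) @[j --> \oo] --> \sum_(i < n) l i.
Proof.
elim: n u l => [|n ih] u l h.
  by under eq_fun do rewrite big_ord0; rewrite big_ord0; exact: cvg_cst.
under eq_fun do rewrite big_ord_recr/=; rewrite big_ord_recr/=.
by apply: cvgD; [apply: ih => i; exact: h|exact: h].
Qed.

Lemma sum_affine n (r : 'I_n -> R) (a b c : R) :
  \sum_(k < n) (a * (r k + b) + c) = a * (\sum_(k < n) r k + n%:R * b) + n%:R * c.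
Proof.
rewrite big_split/= -mulr_sumr big_split/= !sumr_const card_ord.
by rewrite -[b *+ n]mulr_natl -[c *+ n]mulr_natl.
Qed.

(** Along the orbit of iy each increment of the square has real part tending to
    - 2 s(nu), and their sum has real part tending to - 2 s(mu). *)
Lemma root_moment2 : N%:R * moment nu 2 = moment mu 2.
Proof.
have [C [J [C0 hmu hnu hp]]] := root_path.
have pI k j : (k <= N)%N -> j.+1%:R <= Im (path J k j).
  by move=> /hp => /(_ j)[h _ _]; rewrite (le_trans _ h)// ler_nat ltnS leq_addr.
have pR k j : (k <= N)%N -> `|Re (path J k j)| <= 1.
  move=> /hp => /(_ j)[_ h h']; have := le_trans (Re_le_normc _) h.
  rewrite cReD cReN/= subr0 => /le_trans; apply.
  by rewrite ler_pdivrMr ?mul1r// height_gt0.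
have h1 : Re (reciprocal_cauchy mu (path J 0 j) ^+ 2 - path J 0 j ^+ 2)
    @[j --> \oo] --> - 2 * moment mu 2.
  by apply: Re_sqr_increment_cvg => // j; [exact: pI|exact: pR].
have h2 : (\sum_(k < N) Re (F (path J k j) ^+ 2 - path J k j ^+ 2))
    @[j --> \oo] --> \sum_(k < N) (- 2 * moment nu 2).
  apply: cvg_sum_ord => k.
  by apply: Re_sqr_increment_cvg => // j; [apply: pI; exact: ltnW|apply: pR; exact: ltnW].
have {}h2 : Re (reciprocal_cauchy mu (path J 0 j) ^+ 2 - path J 0 j ^+ 2)
    @[j --> \oo] --> \sum_(k < N) (- 2 * moment nu 2).
  by under eq_fun do rewrite sqr_increment_telescope.
have := cvg_lim (@Rhausdorff R) h1; rewrite (cvg_lim (@Rhausdorff R) h2).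
rewrite sumr_const card_ord -[X in X = _]mulr_natl => /(_ _) E.
lra.
Qed.

(** The same telescoping sum, one order further. With u_k the real part of the
    k-th point of the orbit, the nonnegative functions
    y^2 x^2 (x - u_k / 2)^2 / |z_k - x|^2 tend to x^4; their integrals are the
    defects up to O(u_k^2), and the defects are read off from the increments of
    the square. Fatou's lemma then gives both finiteness and the bound. The term
    with factor 8 comes from the crude quadratic error of each step; it is
    O(1 / N) and disappears in the limit of large N. *)
Lemma root_moment4 : has_moment mu 4 -> has_moment nu 4 /\
  N%:R * moment nu 4 <=
    moment mu 4 - 3 / 2 * moment mu 2 ^+ 2 + 8 * N%:R * moment nu 2 ^+ 2.
Proof.
move=> mu4.
have [C [J [C0 hmu hnu hp]]] := root_path.
have [C' mu4C] := Re_sqr_increment_fourth mu2 mu1 mu4.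
have N0' : 0 < N%:R :> R by rewrite ltr0n.
set sm := moment mu 2 in hmu mu4C *; set sn := moment nu 2 in hnu *.
set m4 := moment mu 4 in mu4C *.
set h := height J in hmu hnu hp *.
have h0 j : 0 < h j by exact: height_gt0.
pose p k j := path J k j.
pose w k j x := ((Re (p k j) - x) ^+ 2 + Im (p k j) ^+ 2)^-1.
have pIm k j : (k <= N)%N -> h j <= Im (p k j) by move=> kN; have [] := hp k j kN.
have pIm0 k j : (k <= N)%N -> 0 < Im (p k j) by move=> kN; exact: lt_le_trans (pIm k j kN).
have pRe k j : (k <= N)%N -> `|Re (p k j)| <= C / h j.
  move=> kN; have [_ + _] := hp k j kN => /(le_trans (Re_le_normc _)).
  by rewrite cReD cReN/= subr0.
pose f j x := \sum_(k < N) h j ^+ 2 * (x ^+ 2 * (x - Re (p k j) / 2) ^+ 2 * w k j x).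
have fE k j x : h j ^+ 2 * (x ^+ 2 * (x - Re (p k j) / 2) ^+ 2 * w k j x) =
  h j ^+ 2 * (x ^+ 2 * (x * (x - Re (p k j))) * w k j x) +
  (h j ^+ 2 * Re (p k j) ^+ 2 / 4) * (x ^+ 2 * w k j x).
  by field.
have w_ge0 k j x : (k <= N)%N -> 0 <= w k j x.
  by move=> kN; rewrite invr_ge0 ltW// sqr_dist_gt0// pIm0.
have i1 k j : (k <= N)%N -> integrableR nu (fun x => x ^+ 2 * (x * (x - Re (p k j))) * w k j x).
  by move=> kN; apply: integrableR_defect => //; exact: pIm0.
have wle k j x : (k <= N)%N -> w k j x <= (h j) ^- 2.
  move=> kN; rewrite lef_pV2 ?posrE ?sqr_dist_gt0 ?exprn_gt0 ?pIm0//.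
  rewrite (@le_trans _ _ (Im (p k j) ^+ 2))// ?lerDr ?sqr_ge0//.
  by rewrite ler_pXn2r ?nnegrE ?(ltW (h0 j)) ?(ltW (pIm0 _ _ kN))// pIm.
have i2 k j : (k <= N)%N -> integrableR nu (fun x => x ^+ 2 * w k j x).
  move=> kN; apply: (@integrableR_le _ _ (fun x => (h j) ^- 2 * x ^+ 2)).
  - apply: measurable_funM; first exact: measurable_pow.
    by apply: measurable_inv_sqr_dist; exact: pIm0.
  - move=> x; have wx : 0 <= x ^+ 2 * w k j x by apply: mulr_ge0; [exact: sqr_ge0|exact: w_ge0].
    by rewrite ger0_norm// mulrC ler_wpM2r ?sqr_ge0 ?wle.
  - exact: integrableRZ.
have ik k j : (k <= N)%N -> integrableR nu (fun x => h j ^+ 2 * (x ^+ 2 * (x - Re (p k j) / 2) ^+ 2 * w k j x)).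
  move=> kN; under eq_fun do rewrite fE.
  by apply: integrableRD; apply: integrableRZ; [exact: i1|exact: i2].
have fi j : integrableR nu (f j) by apply: integrableR_sum => k; apply: ik; exact: ltnW.
pose c j := m4 - 3 / 2 * sm ^+ 2 + 8 * N%:R * sn ^+ 2 + C' / 2 / h j +
  N%:R * (C ^+ 2 * sn / 4) / h j ^+ 2.
have fc j : \int[nu]_x f j x <= c j.
  have step k : (k < N)%N ->
    \int[nu]_x (h j ^+ 2 * (x ^+ 2 * (x - Re (p k j) / 2) ^+ 2 * w k j x)) <=
    h j ^+ 2 / 2 * (Re (F (p k j) ^+ 2 - p k j ^+ 2) + 2 * sn) + 8 * sn ^+ 2
    + (C ^+ 2 * sn / 4) / h j ^+ 2.
    move=> /ltnW kN; under eq_Rintegral do rewrite fE.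
    have hi := i1 k j kN; have hi2 := i2 k j kN.
    rewrite RintD ?(RintZ _ hi) ?(RintZ _ hi2); [|exact: integrableRZ..].
    apply: lerD.
      rewrite -/(defect nu (p k j)).
      have := Re_sqr_increment nu2 nu1 (le_trans (hnu j) (pIm k j kN)).
      set r := Re _; rewrite -/sn => hr.
      have : `|2 * defect nu (p k j) - (r + 2 * sn)| <= 16 * (sn / h j) ^+ 2.
        rewrite -normrN opprB (_ : _ - _ = r + 2 * (sn - defect nu (p k j))); last by ring.
        rewrite (le_trans hr)// ler_wpM2l// ler_pXn2r ?nnegrE ?mulr_ge0 ?invr_ge0 ?moment2_ge0 ?(ltW (h0 j)) ?(ltW (pIm0 _ _ kN))//.
        by rewrite ler_wpM2l ?moment2_ge0// lef_pV2 ?posrE ?pIm ?pIm0.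
      move=> /(le_trans (ler_norm _)); rewrite lerBlDl => hd.
      have : h j ^+ 2 * (2 * defect nu (p k j)) <= h j ^+ 2 * (r + 2 * sn + 16 * (sn / h j) ^+ 2).
        by rewrite ler_pM2l// exprn_gt0.
      have -> : h j ^+ 2 * (r + 2 * sn + 16 * (sn / h j) ^+ 2) = h j ^+ 2 * (r + 2 * sn) + 16 * sn ^+ 2.
        by field; rewrite gt_eqF.
      lra.
    (* |u_k| <= C / y bounds the correction that completes the square. *)
    have -> : C ^+ 2 * sn / 4 / h j ^+ 2 = (h j ^+ 2 * (C / h j) ^+ 2 / 4) * (h j ^- 2 * sn).
      by field; rewrite gt_eqF.
    apply: ler_pM.
    - by rewrite divr_ge0// mulr_ge0 ?sqr_ge0.
    - by apply: Rint_ge0 => x; apply: mulr_ge0; [exact: sqr_ge0|exact: w_ge0].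
    - rewrite ler_pM2r// ler_pM2l ?exprn_gt0// -[_ (p k j) ^+ 2]real_normK ?num_real//.
      by rewrite ler_pXn2r ?nnegrE ?divr_ge0 ?(ltW (h0 j))// pRe.
    - rewrite -RintZ//; apply: Rint_le => //; first exact: integrableRZ.
      by move=> x; rewrite mulrC ler_wpM2r ?sqr_ge0 ?wle.
  rewrite Rint_sum; last by move=> k; apply: ik; exact: ltnW.
  apply: (@le_trans _ _ (\sum_(k < N)
    (h j ^+ 2 / 2 * (Re (F (p k j) ^+ 2 - p k j ^+ 2) + 2 * sn) + 8 * sn ^+ 2
     + (C ^+ 2 * sn / 4) / h j ^+ 2))).
    by apply: ler_sum => k _; exact: step.
  rewrite (eq_bigr (fun k : 'I_N => h j ^+ 2 / 2 * (Re (F (p k j) ^+ 2 - p k j ^+ 2) + 2 * sn) +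
    (8 * sn ^+ 2 + (C ^+ 2 * sn / 4) / h j ^+ 2))); last by move=> k _; rewrite addrA.
  rewrite sum_affine.
  have := mu4C _ (hmu j).
  have := sqr_increment_telescope J j; rewrite -/(h j) => ->.
  have := root_moment2; rewrite -/sm -/sn => snm.
  rewrite /c -snm -/sn; rewrite -[path J]/p; move: (\sum_(k < N) _) => r.
  have hj := h0 j; move: (h j) hj => y y0 hr.
  have -> : N%:R * (2 * sn) = 2 * (N%:R * sn) by ring.
  have -> : C' / 2 / y = C' / y / 2 by field; rewrite gt_eqF.
  lra.
have hV : (h j)^-1 @[j --> \oo] --> (0 : R).
  by have := @cvg_harmonic R; rewrite -(cvg_shiftn J).
have [] := @Fatou_cvg _ nu f (fun x => N%:R * x ^+ 4) c (m4 - 3 / 2 * sm ^+ 2 + 8 * N%:R * sn ^+ 2).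
- by move=> j; apply: integrableR_meas; exact: fi.
- move=> j x; apply: sumr_ge0 => k _.
  apply: mulr_ge0; first exact: sqr_ge0.
  apply: mulr_ge0; last by apply: w_ge0; exact: ltnW.
  by apply: mulr_ge0; apply: sqr_ge0.
- by apply: measurable_funM; [exact: measurable_cst|exact: measurable_pow].
- move=> x; have -> : N%:R * x ^+ 4 = \sum_(k < N) x ^+ 4.
    by rewrite sumr_const card_ord mulr_natl.
  apply: cvg_sum_ord => k; have kN : (k <= N)%N by exact: ltnW.
  have Re0 : Re (p k j) @[j --> \oo] --> (0 : R).
    apply/norm_cvg0P; apply: (@squeeze_cvgr _ _ _ _ (fun=> 0) (fun j => C * (h j)^-1)).
    + by near=> j; rewrite normr_ge0/= pRe.
    + exact: cvg_cst.
    + by rewrite -[X in _ --> X](mulr0 C); apply: cvgM; [exact: cvg_cst|].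
  have Im1 : Im (p k j) * (h j)^-1 @[j --> \oo] --> (1 : R).
    apply/subr_cvg0/norm_cvg0P.
    apply: (@squeeze_cvgr _ _ _ _ (fun=> 0) (fun j => C * (h j)^-1 * (h j)^-1)).
    + near=> j; rewrite normr_ge0/=; have [_ + _] := hp k j kN => /(le_trans (Im_le_normc _)).
      rewrite cImD cImN/= => hI.
      have -> : Im (p k j) / h j - 1 = (Im (p k j) - h j) * (h j)^-1.
        by rewrite mulrBl divff// gt_eqF.
      by rewrite normrM [X in _ * X]gtr0_norm ?invr_gt0// ler_pM2r ?invr_gt0.
    + exact: cvg_cst.
    + by rewrite -[X in _ --> X](mulr0 (C * 0)); apply: cvgM => //; apply: cvgM; [exact: cvg_cst|].
  (* Dividing by y^2 exposes the three limits Re z_k -> 0, Im z_k / y -> 1, 1 / y -> 0. *)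
  have E j : h j ^+ 2 * (x ^+ 2 * (x - Re (p k j) / 2) ^+ 2 * w k j x) =
    x ^+ 2 * (x - Re (p k j) / 2) ^+ 2 *
    (((Re (p k j) - x) * (h j)^-1) ^+ 2 + (Im (p k j) * (h j)^-1) ^+ 2)^-1.
    rewrite /w; have d0 := sqr_dist_gt0 (Re (p k j) - x) (pIm0 k j kN).
    by field; rewrite !gt_eqF.
  under eq_fun do rewrite E.
  have -> : x ^+ 4 = x ^+ 2 * (x - 0 / 2) ^+ 2 * (((0 - x) * 0) ^+ 2 + 1 ^+ 2)^-1.
    by rewrite mulr0 expr0n/= expr1n add0r invr1; ring.
  apply: cvgM.
    apply: cvgM; first exact: cvg_cst.
    by apply: cvg_sqr; apply: cvgB; [exact: cvg_cst|apply: cvgM; last exact: cvg_cst].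
  apply: cvgV; first by rewrite mulr0 expr0n/= expr1n add0r oner_neq0.
  apply: cvgD; apply: cvg_sqr => //; apply: cvgM => //.
  by apply: cvgB; [|exact: cvg_cst].
- by apply: nearW => j; split; [exact: fi|exact: fc].
- rewrite -[X in _ --> X]addr0; apply: cvgD.
    rewrite -[X in _ --> X]addr0; apply: cvgD; first exact: cvg_cst.
    by rewrite -[X in _ --> X](mulr0 (C' / 2)); apply: cvgM; [exact: cvg_cst|].
  rewrite -[X in _ --> X](mulr0 (N%:R * (C ^+ 2 * sn / 4))); apply: cvgM; first exact: cvg_cst.
  by have := cvg_sqr hV; rewrite expr0n/=; under eq_fun do rewrite exprVn.
move=> h4 hN; have nu4 : has_moment nu 4.
  have := integrableRZ (N%:R^-1) h4; rewrite /has_moment; congr integrableR; apply/funext => x.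
  by rewrite mulKf// gt_eqF.
by split => //; move: hN; rewrite RintZ.
Unshelve. all: by end_near. Qed.

End root_fourth_moment.

(** * Distance to the arcsine law in terms of the fourth moment *)

Section fourth_moment_bound.
Context {R : realType}.
Notation Re := complex.Re.
Notation Im := complex.Im.

(** The arithmetic-geometric inequality 2 t^3 <= th t^2 + t^4 / th. *)
Lemma abs_moment3_le (nu : borel_probability R) (th : R) : 0 < th -> has_moment nu 4 ->
  2 * abs_moment nu 3 <= th * moment nu 2 + moment nu 4 / th.
Proof.
move=> th0 h4; have h3 : has_moment nu 3 by exact: has_moment_le h4.
have h2 : has_moment nu 2 by exact: has_moment_le h4.
have h3' := has_moment_abs h3; rewrite [moment nu 4 / th]mulrC /abs_moment /moment.
rewrite -(RintZ _ h2) -(RintZ _ h4) -(RintZ _ h3').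
rewrite -RintD; [|exact: integrableRZ..]; apply: Rint_le.
- exact: integrableRZ.
- by apply: integrableRD; exact: integrableRZ.
move=> x; rewrite -[x ^+ 2]real_normK ?num_real//.
have -> : x ^+ 4 = `|x| ^+ 4 by rewrite -normrX ger0_norm// exprn_even_ge0.
move: `|x| => t; rewrite -subr_ge0.
have -> : th * t ^+ 2 + th^-1 * t ^+ 4 - 2 * t ^+ 3 = th^-1 * (t ^+ 2 - th * t) ^+ 2.
  by field; rewrite gt_eqF.
by rewrite mulr_ge0 ?sqr_ge0// invr_ge0 ltW.
Qed.

(** One step of the iteration changes the square by - 2 s. The error is
    governed by the third absolute moment, uniformly above height y. *)
Lemma sqr_step_le (nu : borel_probability R) (y : R) (z : R[i]) :
  has_moment nu 3 -> moment nu 1 = 0 -> 0 < y -> y <= Im z ->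
  2 * moment nu 2 <= y ^+ 2 ->
  normc (reciprocal_cauchy nu z ^+ 2 - z ^+ 2 + 2 * (moment nu 2)%:C) <=
  16 * (moment nu 2 / y) ^+ 2 + 2 * abs_moment nu 3 / y.
Proof.
move=> h3 nu1 y0 yz sy; have nu2 : has_moment nu 2 by exact: has_moment_le h3.
have s0 := moment2_ge0 nu; set s := moment nu 2 in sy s0 *.
have z0 : 0 < Im z by exact: lt_le_trans yz.
have Kh : normc (cauchy_pow nu 1 z) <= 1 / 2.
  rewrite (le_trans (normc_cauchy_pow1_le nu2 nu1 z0))// ler_pdivrMr ?exprn_gt0//.
  have : y ^+ 2 <= Im z ^+ 2 by rewrite ler_pXn2r ?nnegrE ?(ltW y0) ?(ltW z0).
  by rewrite -/s; lra.
have kE : kappa nu z = s%:C + cauchy_pow nu 3 z by exact: cauchy_powS.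
have -> : reciprocal_cauchy nu z ^+ 2 - z ^+ 2 + 2 * s%:C =
  (reciprocal_cauchy nu z ^+ 2 - z ^+ 2 + 2 * kappa nu z) - 2 * cauchy_pow nu 3 z.
  by rewrite kE; ring.
rewrite (le_trans (normc_le_sub _ _))// lerD//.
  rewrite (le_trans (reciprocal_cauchy_sqr_approx nu2 nu1 z0 Kh))// ler_wpM2l//.
  rewrite ler_pXn2r ?nnegrE ?divr_ge0 ?normc_ge0 ?(ltW y0)//.
  rewrite (le_trans (normc_kappa_le nu2 z0))// ler_wpM2l// lef_pV2 ?posrE//.
rewrite normcM normc_natr -mulrA ler_wpM2l// (le_trans (normc_cauchy_pow z0 h3))//.
by rewrite ler_wpM2l ?abs_moment_ge0// lef_pV2 ?posrE.
Qed.

(** The arcsine law is characterized by F(z)^2 = z^2 - 2. A monotone infinitely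
    divisible mu satisfies this up to an error controlled by m4 - 3 / 2: write mu as
    an N-fold power and add up N steps. Each root has third absolute moment
    at most (th + (m4 - 3 / 2) / th) / (2 N) up to
    O(1 / N^2), whence the stated bound; all remaining
    errors are O(1 / N), and N is arbitrary. *)
Theorem reciprocal_cauchy_arcsine_bound (mu : borel_probability R) :
  monotone_infinitely_divisible mu -> has_moment mu 4 ->
  moment mu 1 = 0 -> moment mu 2 = 1 ->
  forall (th : R) (z : R[i]), 0 < th -> 0 < Im z ->
  normc (reciprocal_cauchy mu z ^+ 2 - z ^+ 2 + 2) <=
    (th + (moment mu 4 - 3 / 2) / th) / Im z.
Proof.
move=> ID mu4 mu1 mu2 th z th0 z0; set y := Im z; set m4 := moment mu 4.
have hmu2 : has_moment mu 2 by exact: has_moment_le mu4.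
(* B / N is the sum of the errors that vanish as N grows. *)
set B := 16 / y ^+ 2 + 8 / th / y.
have B0 : 0 <= B by rewrite addr_ge0// ?divr_ge0// ?exprn_ge0 ?ltW// divr_gt0.
apply/ler_addgt0Pr => e e0.
set M := 2 / y ^+ 2 + B / e.
have M0 : 0 <= M by rewrite addr_ge0// divr_ge0// ?exprn_ge0 ?ltW.
have [N N0 NM] : exists2 N : nat, (0 < N)%N & M <= N%:R.
  by exists (Num.bound M).+1 => //; rewrite (@le_trans _ _ (Num.bound M)%:R) ?ler_nat// ltW// archi_boundP.
have [nu nuN] := ID N N0.
have Nr : 0 < N%:R :> R by rewrite ltr0n.
have snu := root_moment2 N0 nuN hmu2 mu1; rewrite mu2 in snu.
have sE : moment nu 2 = N%:R^-1 by apply: (mulfI (lt0r_neq0 Nr)); rewrite snu divff ?gt_eqF.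
have [nu4 m4nu] := root_moment4 N0 nuN hmu2 mu1 mu4.
have nu1 := root_moment1 N0 nuN hmu2 mu1.
have nu3 : has_moment nu 3 by exact: has_moment_le nu4.
have yN : 2 / N%:R <= y ^+ 2.
  rewrite ler_pdivrMr// mulrC -ler_pdivrMr ?exprn_gt0//.
  by rewrite (le_trans _ NM)// lerDl divr_ge0// ltW.
have BN : B / N%:R <= e.
  rewrite ler_pdivrMr// mulrC -ler_pdivrMr//.
  by rewrite (le_trans _ NM)// lerDr divr_ge0// exprn_ge0// ltW.
have E : reciprocal_cauchy mu z ^+ 2 - z ^+ 2 + 2 =
  \sum_(k < N) (reciprocal_cauchy nu (iter k (reciprocal_cauchy nu) z) ^+ 2 -
    iter k (reciprocal_cauchy nu) z ^+ 2 + 2 * (moment nu 2)%:C).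
  rewrite big_split/= -iter_sqr_telescope -(monotone_pow_iter nuN)//; congr (_ + _).
  rewrite sumr_const card_ord sE -[RHS]mulr_natr -mulrA.
  by rewrite -(rmorph_nat (real_complex R) N) -rmorphM/= mulVf ?gt_eqF// mulr1.
rewrite E (le_trans (normc_sum _))//.
apply: (@le_trans _ _ (\sum_(k < N) (16 * (moment nu 2 / y) ^+ 2 + 2 * abs_moment nu 3 / y))).
  by apply: ler_sum => k _; apply: sqr_step_le => //; [exact: Im_iter_ge|rewrite sE].
rewrite sumr_const card_ord -[leLHS]mulr_natl.
have a3 := abs_moment3_le th0 nu4.
rewrite mu2 expr1n mulr1 sE in m4nu.
apply: (@le_trans _ _ ((th + (m4 - 3 / 2) / th) / y + B / N%:R)); last by rewrite lerD2l.
have -> : (th + (m4 - 3 / 2) / th) / y + B / N%:R =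
  N%:R * (16 * (N%:R^-1 / y) ^+ 2) +
  (th + (m4 - 3 / 2 + 8 * N%:R * N%:R^-1 ^+ 2) / th) / y.
  by rewrite /B; field; rewrite !gt_eqF.
rewrite sE mulrDr lerD2l mulrA ler_pM2r ?invr_gt0//.
have : N%:R * (2 * abs_moment nu 3) <= N%:R * (th * moment nu 2 + moment nu 4 / th).
  by rewrite ler_pM2l.
move=> /le_trans; apply; rewrite sE mulrDr mulrCA divff ?gt_eqF// mulr1 lerD2l mulrA.
by rewrite ler_pM2r ?invr_gt0.
Qed.

End fourth_moment_bound.

(** * Stieltjes inversion from below *)

Section poisson.
Context {R : realType}.
Notation leb := (@lebesgue_measure R).
Notation Re := complex.Re.
Notation Im := complex.Im.

Definition poisson (y x t : R) : R := y / pi * ((t - x) ^+ 2 + y ^+ 2)^-1.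

Lemma poisson_ge0 y x t : 0 < y -> 0 <= poisson y x t.
Proof.
move=> y0; rewrite mulr_ge0 ?divr_ge0 ?pi_ge0 ?(ltW y0)// invr_ge0 ltW//.
exact: sqr_dist_gt0.
Qed.

Lemma poisson_continuous y x : 0 < y -> continuous (poisson y x).
Proof.
move=> y0 t; apply: cvgM; first exact: cvg_cst.
apply: cvgV; first by rewrite gt_eqF// sqr_dist_gt0.
apply: cvgD; last exact: cvg_cst.
have h : {for t, continuous (fun t : R => t - x)}.
  by apply: cvgB; [exact: cvg_id|exact: cvg_cst].
exact: (continuous_comp h (@exprn_continuous _ 2 _)).
Qed.

Lemma is_derive_atan_poisson y x (t : R) : 0 < y ->
  is_derive t 1 (fun t : R => atan ((t - x) / y) / pi) (poisson y x t).
Proof.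
move=> y0.
have d1 : is_derive t 1 (fun t : R => (t - x) / y) y^-1.
  rewrite [X in is_derive _ _ X _](_ : _ = (y^-1 \*: ((@id R : R -> R^o) - cst x))); last first.
    by apply/funext => u /=; rewrite mulrC.
  apply: is_derive_eq.
  by rewrite subr0 /GRing.scale/= mulr1.
have d2 := is_derive1_atan ((t - x) / y).
have d3 := @is_derive1_comp R atan (fun t : R => (t - x) / y) t _ _ d2 d1.
rewrite [X in is_derive _ _ X _](_ : _ = pi^-1 \*: ((@atan R \o (fun t => (t - x) / y)) : R -> R^o)); last first.
  by apply/funext => u /=; rewrite mulrC.
apply: is_derive_eq.
rewrite /GRing.scale/= /poisson.
have h := sqr_dist_gt0 (t - x) y0.
move: (pi : R) (@pi_gt0 R) => p p0.
field.
by rewrite !gt_eqF//=.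
Qed.

(** The primitive is atan ((t - x) / y) / pi, whose range has length less
    than one. *)
Lemma poisson_mass_le1 y x a b : 0 < y -> a < b ->
  (\int[leb]_(t in `[a, b]) (poisson y x t)%:E <= 1)%E.
Proof.
move=> y0 ab; set F := fun t : R => atan ((t - x) / y) / pi.
have dF t := is_derive_atan_poisson x t y0.
have Fc t : {for t, continuous F}.
  by have := dF t => dFt; apply/differentiable_continuous/derivable1_diffP; exact: ex_derive.
rewrite (@continuous_FTC2 _ (poisson y x) F)//.
- rewrite -EFinB lee_fin /F -mulrBl ler_pdivrMr ?pi_gt0// mul1r.
  have := atan_ltpi2 ((b - x) / y); have := atan_gtNpi2 ((a - x) / y); lra.
- by apply: continuous_subspaceT; exact: poisson_continuous.
- split.
  + by move=> t _; have := dF t => dFt; exact: ex_derive.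
  + by apply: cvg_at_right_filter; exact: Fc.
  + by apply: cvg_at_left_filter; exact: Fc.
- by move=> t _; have := dF t => dFt; rewrite derive1E derive_val.
Qed.

Lemma continuous_near_itv (g : R -> R) (a b e : R) : continuous g -> 0 < e ->
  exists2 d, 0 < d & forall t x, t \in `[a, b] -> `|t - x| < d -> `|g t - g x| <= e.
Proof.
move=> gc e0.
have /compact_near_coveringP/(_ R (0 : R)^'+ (fun d t => forall x, `|t - x| < d -> `|g t - g x| <= e) _) :=
  @segment_compact R a b.
move=> /(_ _)[].
  move=> t _.
  have e20 : 0 < e / 2 by rewrite divr_gt0.
  have /cvgrPdist_lt/(_ _ e20) := gc t; rewrite near_simpl => /nbhs_ballP[r /= r0 hr].
  have r20 : 0 < r / 2 by rewrite divr_gt0.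
  exists (ball t (r / 2), [set d | 0 < d < r / 2]) => /=.
    split; first exact: nbhsx_ballx.
    by near=> d; apply/andP; split.
  move=> [t' d] /= [tt' /andP[d0 dr]] x t'x.
  have h1 : `|g t - g t'| < e / 2.
    by apply: hr; move: tt'; rewrite /ball/=; lra.
  have h2 : `|g t - g x| < e / 2.
    apply: hr; move: tt'; rewrite /ball/= => tt'.
    have -> : t - x = (t - t') + (t' - x) by ring.
    rewrite (le_lt_trans (ler_normD _ _))//; lra.
  have -> : g t' - g x = - (g t - g t') + (g t - g x) by ring.
  by rewrite (le_trans (ler_normD _ _))// normrN; lra.
move=> d /= d0 hd.
exists (d / 2); first by rewrite divr_gt0.
move=> t x tab tx; apply: (hd (d / 2)) => //=; rewrite ?divr_gt0//.
rewrite sub0r normrN gtr0_norm ?divr_gt0//; lra.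
Unshelve. all: by end_near. Qed.

End poisson.

Section stieltjes_inversion.
Context {R : realType}.
Notation leb := (@lebesgue_measure R).
Notation Re := complex.Re.
Notation Im := complex.Im.

(** The density of the convolution of mu with the Cauchy law of scale y. *)
Definition stieltjes_density (mu : borel_probability R) (y t : R) : R :=
  - Im (cauchy_transform mu (t +i* y)) / pi.

Lemma measurable_poisson_pair (y : R) : 0 < y ->
  measurable_fun [set: measurableTypeR R * measurableTypeR R]
    (fun p => poisson y p.1 p.2).
Proof.
move=> y0; apply: measurable_funM; first exact: measurable_cst.
have -> : (fun p : measurableTypeR R * measurableTypeR R => ((p.2 - p.1) ^+ 2 + y ^+ 2)^-1) =
    (fun d : R => ((0 - d) ^+ 2 + y ^+ 2)^-1) \o (fun p => p.1 - p.2).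
  by apply/funext => p /=; rewrite sub0r opprB.
apply: measurableT_comp; first exact: measurable_inv_sqr_dist.
by apply: measurable_funB; [exact: measurable_fst|exact: measurable_snd].
Qed.

Lemma integral_poisson (mu : borel_probability R) (y t : R) : 0 < y ->
  (\int[mu]_x (poisson y x t)%:E = (stieltjes_density mu y t)%:E)%E.
Proof.
move=> y0; have hi := integrableR_inv_sqr_dist mu t y0.
rewrite Rint_EFin; last exact: integrableRZ.
rewrite (RintZ _ hi) /stieltjes_density (Im_cauchy_transform mu (z := t +i* y) y0)/=.
by rewrite mulrAC.
Qed.

Section poisson_fubini.
Variables (g : R -> R) (y a b : R).
Hypothesis y0 : 0 < y.
Hypothesis gc : continuous g.
Hypothesis g0 : forall x, 0 <= g x.

Let I : set R := `[a, b]%classic.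

Let f (p : measurableTypeR R * measurableTypeR R) : \bar R :=
  (g p.2 * \1_I p.2 * poisson y p.1 p.2)%:E.

Let mf : measurable_fun setT f.
Proof.
apply/measurable_EFinP; apply: measurable_funM; last exact: measurable_poisson_pair.
apply: measurable_funM.
  apply: (measurableT_comp (f := g)); last exact: measurable_snd.
  exact: continuous_measurable_fun.
have m1 : measurable_fun [set: measurableTypeR R] (\1_I : measurableTypeR R -> R).
  by apply: measurable_indic; exact: measurable_itv.
exact: (measurableT_comp m1 measurable_snd).
Qed.

Let f0 p : (0 <= f p)%E.
Proof. by rewrite lee_fin mulr_ge0 ?poisson_ge0// mulr_ge0. Qed.

Let integral_itvE (h : R -> R) :
  (\int[leb]_(t in I) (h t)%:E = \int[leb]_t (\1_I t * h t)%:E)%E.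
Proof.
rewrite integral_mkcond; apply: eq_integral => t _.
by rewrite patchE indicE; case: ifP => _; rewrite ?mul1r ?mul0r.
Qed.

Let averageE x : (\int[leb]_(t in I) (g t * poisson y x t)%:E =
  \int[leb]_t f (x, t))%E.
Proof.
rewrite integral_itvE; apply: eq_integral => t _.
by rewrite /f/=; congr (_%:E); ring.
Qed.

Lemma measurable_poisson_average : measurable_fun [set: R]
  (fun x => \int[leb]_(t in `[a, b]) (g t * poisson y x t)%:E)%E.
Proof.
under eq_fun do rewrite averageE.
exact: (measurable_fun_fubini_tonelli_F f mf f0).
Qed.

Lemma poisson_fubini (mu : borel_probability R) :
  (\int[mu]_x \int[leb]_(t in `[a, b]) (g t * poisson y x t)%:E =
   \int[leb]_(t in `[a, b]) (g t * stieltjes_density mu y t)%:E)%E.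
Proof.
under eq_integral do rewrite averageE.
rewrite (@fubini_tonelli _ _ _ _ _ mu leb f mf f0) integral_itvE.
apply: eq_integral => t _.
rewrite /f/=; under eq_integral do rewrite EFinM.
rewrite ge0_integralZl//.
- by rewrite integral_poisson// -EFinM; congr (_%:E); ring.
- apply/measurable_EFinP; apply: measurable_funM; first exact: measurable_cst.
  exact: measurable_inv_sqr_dist.
- by move=> x _; rewrite lee_fin poisson_ge0.
- by rewrite lee_fin mulr_ge0.
Qed.

End poisson_fubini.

Lemma measurable_stieltjes_density (mu : borel_probability R) (y : R) : 0 < y ->
  measurable_fun [set: R] (stieltjes_density mu y).
Proof.
move=> y0; apply/measurable_EFinP.
have -> : EFin \o stieltjes_density mu y = fun t => (\int[mu]_x (poisson y x t)%:E)%E.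
  by apply/funext => t; rewrite integral_poisson.
pose f (p : measurableTypeR R * measurableTypeR R) : \bar R := (poisson y p.1 p.2)%:E.
apply: (@measurable_fun_fubini_tonelli_G _ _ _ _ _ mu f).
  by apply/measurable_EFinP; exact: measurable_poisson_pair.
by move=> p; rewrite lee_fin poisson_ge0.
Qed.

(** The points t closer than d to x contribute at most (g x + e) times the
    Poisson mass of the interval, which is at most one; the other points
    contribute at most B times the supremum of the kernel away from x. *)
Lemma poisson_average_le (g : R -> R) (B y d e a b x : R) :
  0 < y -> 0 < d -> 0 <= e -> a < b -> continuous g ->
  (forall x, 0 <= g x) -> (forall x, g x <= B) ->
  (forall t x, t \in `[a, b] -> `|t - x| < d -> `|g t - g x| <= e) ->
  (\int[leb]_(t in `[a, b]) (g t * poisson y x t)%:E <=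
    (g x + e + B * (y / pi / d ^+ 2) * (b - a))%:E)%E.
Proof.
move=> y0 d0 e0 ab gc g0 gB gd.
have B0 : 0 <= B by exact: le_trans (g0 0) (gB 0).
have pi0 := @pi_gt0 R.
set c := B * (y / pi / d ^+ 2).
have c0 : 0 <= c.
  by rewrite mulr_ge0// !mulr_ge0 ?invr_ge0 ?exprn_ge0 ?(ltW pi0) ?(ltW y0) ?(ltW d0).
have ge0 : 0 <= g x + e by rewrite addr_ge0.
have mI : measurable (`[a, b]%classic : set R) by [].
have mP : measurable_fun `[a, b]%classic (poisson y x).
  apply: measurable_funTS; apply: continuous_measurable_fun.
  exact: poisson_continuous.
apply: (@le_trans _ _ (\int[leb]_(t in `[a, b]) ((g x + e)%:E * (poisson y x t)%:E + c%:E))%E).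
  apply: ge0_le_integral => //.
  - by move=> t _; rewrite lee_fin mulr_ge0 ?poisson_ge0.
  - apply/measurable_EFinP; apply: measurable_funM => //.
    by apply: measurable_funTS; exact: continuous_measurable_fun.
  - by apply: emeasurable_funD => //; apply: emeasurable_funM => //; exact/measurable_EFinP.
  - move=> t tI; rewrite -EFinM -EFinD lee_fin.
    have p0 := poisson_ge0 x t y0.
    have [tx|tx] := ltP `|t - x| d.
      rewrite (@le_trans _ _ ((g x + e) * poisson y x t)) ?lerDl// ler_wpM2r//.
      by have := gd t x tI tx; move=> /(le_trans (ler_norm _)); lra.
    apply: (@le_trans _ _ c); last by rewrite lerDr mulr_ge0.
    rewrite /c ler_pM//.
    rewrite /poisson ler_wpM2l ?divr_ge0 ?(ltW pi0) ?(ltW y0)//.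
    rewrite lef_pV2 ?posrE ?exprn_gt0 ?sqr_dist_gt0//.
    rewrite -[(t - x) ^+ 2]real_normK ?num_real//.
    have : d ^+ 2 <= `|t - x| ^+ 2 by rewrite ler_pXn2r ?nnegrE// ltW.
    by have := sqr_ge0 y; lra.
rewrite ge0_integralD//; last 2 first.
- by move=> t _; rewrite -EFinM lee_fin mulr_ge0// poisson_ge0.
- by apply: emeasurable_funM => //; exact/measurable_EFinP.
rewrite ge0_integralZl//; last 2 first.
- exact/measurable_EFinP.
- by move=> t _; rewrite lee_fin poisson_ge0.
rewrite [X in (_ + X)%E]integral_cst//= lebesgue_measure_itv/= lte_fin ab -EFinB -EFinM [leRHS]EFinD.
apply: leeD => //.
rewrite -[leRHS]mule1 lee_wpmul2l//; exact: poisson_mass_le1.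
Qed.

(** If F^2 is close to - c, then F is close to i sqrt c, as it lies in the upper
    half-plane. This selects the branch of the square root, and bounds
    Im F / |F|^2 = - Im G from below. *)
Lemma Im_div_sqr_ge (w : R[i]) (c h : R) : 0 < Im w -> 0 < c -> 0 <= h -> h <= c ->
  normc (w ^+ 2 + c%:C) <= h ->
  (1 - 2 * (h / c)) / Num.sqrt c <= Im w / normc w ^+ 2.
Proof.
move=> w0 c0 h0 hc wc.
have n0 : 0 < normc w ^+ 2 by rewrite exprn_gt0// normc_gt0 Im_neq0.
set r := Num.sqrt c; have r0 : 0 < r by rewrite sqrtr_gt0.
have rr : r ^+ 2 = c by rewrite sqr_sqrtr// ltW.
set q := h / c.
have q0 : 0 <= q by rewrite divr_ge0// ltW.
have q1 : q <= 1 by rewrite ler_pdivrMr// mul1r.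
have hq : h = q * r ^+ 2 by rewrite rr /q divfK// gt_eqF.
have nw : normc w ^+ 2 <= r ^+ 2 * (1 + q).
  have : normc (w ^+ 2) <= h + c.
    rewrite -[w ^+ 2](addrK c%:C) (le_trans (normc_le_sub _ _))// normc_real.
    by rewrite (gtr0_norm c0) lerD2r.
  by rewrite normcXn hq -rr; lra.
have Iw : (r * (1 - q)) ^+ 2 <= Im w ^+ 2.
  have := le_trans (Re_le_normc _) wc; rewrite cReD/= expr2 cReM.
  move=> /(le_trans (ler_norm _)); rewrite hq -rr => Hw.
  have h2 : r ^+ 2 * (1 - q) <= Im w ^+ 2 by have := sqr_ge0 (Re w); lra.
  apply: le_trans h2; rewrite exprMn ler_wpM2l ?sqr_ge0// expr2 ler_piMl; lra.
have {}Iw : r * (1 - q) <= Im w.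
  by move: Iw; rewrite ler_pXn2r ?nnegrE ?(ltW w0)// mulr_ge0 ?(ltW r0)// subr_ge0.
rewrite ler_pdivlMr//.
have [q2|q2] := leP (1 - 2 * q) 0.
  apply: le_trans (ltW w0); rewrite mulr_le0_ge0 ?(ltW n0)//.
  by rewrite mulr_le0_ge0// invr_ge0 ltW.
apply: le_trans Iw; apply: (@le_trans _ _ ((1 - 2 * q) / r * (r ^+ 2 * (1 + q)))).
  by rewrite ler_wpM2l// divr_ge0 ?(ltW q2) ?(ltW r0).
have -> : (1 - 2 * q) / r * (r ^+ 2 * (1 + q)) = r * ((1 - 2 * q) * (1 + q)).
  by field; rewrite gt_eqF.
rewrite ler_pM2l//; have := sqr_ge0 q; lra.
Qed.

End stieltjes_inversion.

(** * Integration against the arcsine law *)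

Section arcsine_integral.
Context {R : realType}.
Notation leb := (@lebesgue_measure R).

Lemma integral_arcsine_pdf_set U : measurable U ->
  (\int[leb]_(x in U) (arcsine_pdf x)%:E = arcsine_prob R U :> \bar R)%E.
Proof. by []. Qed.

Lemma arcsine_prob_dominates : arcsine_prob R `<< leb.
Proof.
apply/null_content_dominatesP=> A mA muA0.
apply: null_set_integral => //.
apply/measurable_funTS/measurable_EFinP; exact: measurable_arcsine_pdf.
Qed.

(** The Radon-Nikodym derivative of the arcsine law is its density, because
    both have the same integrals over measurable sets. *)
Lemma integral_arcsine_prob (f : R -> R) : integrableR (arcsine_prob R) f ->
  (\int[arcsine_prob R]_x (f x)%:E = \int[leb]_x (f x * arcsine_pdf x)%:E)%E.
Proof.
move=> fi.
rewrite -(Radon_Nikodym_change_of_variables arcsine_prob_dominates)//=.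
apply: ae_eq_integral => //.
- apply: emeasurable_funM => //; first exact: measurable_int fi.
  apply: (measurable_int leb).
  by apply: Radon_Nikodym_integrable; exact: arcsine_prob_dominates.
- apply/measurable_EFinP; apply: measurable_funM; first exact: integrableR_meas fi.
  exact: measurable_arcsine_pdf.
- under [X in ae_eq _ _ _ X]eq_fun do rewrite EFinM.
  apply: ae_eqe_mul2l => /=.
  rewrite Radon_NikodymE//=; first exact: arcsine_prob_dominates.
  move=> abmu.
  case: cid => /= h [h1 h2 h3].
  apply: integral_ae_eq => //=.
  + by apply/measurable_EFinP; exact: measurable_arcsine_pdf.
  + by move=> E E01 mE; rewrite -h3//= integral_arcsine_pdf_set.
Qed.

End arcsine_integral.

Lemma sqr_lt2E {R : realType} (t : R) : (t ^+ 2 < 2) = (`|t| < Num.sqrt 2).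
Proof.
rewrite -[t ^+ 2]real_normK ?num_real// -[in LHS](@sqr_sqrtr R 2)//.
by rewrite ltr_pXn2r ?nnegrE.
Qed.

Section arcsine_lower_bound.
Context {R : realType}.
Notation leb := (@lebesgue_measure R).
Notation Re := complex.Re.
Notation Im := complex.Im.
Variables (g : R -> R) (B : R).
Hypothesis gc : continuous g.
Hypothesis g0 : forall x, 0 <= g x.
Hypothesis gB : forall x, g x <= B.

Let mg : measurable_fun [set: R] g. Proof. exact: continuous_measurable_fun. Qed.

Lemma integrableR_continuous_bounded (mu : borel_probability R) : integrableR mu g.
Proof. by apply: (integrableR_bounded mu mg (c := B)) => x; rewrite ger0_norm. Qed.

Lemma integrableR_indic (mu : borel_probability R) (D : set R) : measurable D ->
  integrableR mu (fun x => g x * \1_D x).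
Proof.
move=> mD; apply: (@integrableR_bounded _ _ B).
  by apply: measurable_funM => //; exact: measurable_indic.
move=> x; rewrite ger0_norm ?mulr_ge0// (le_trans _ (gB x))// ler_piMr// indicE.
Qed.

Lemma integral_arcsine_itv (a b : R) :
  ((\int[arcsine_prob R]_x (g x * \1_`[a, b] x))%:E =
   \int[leb]_(t in `[a, b]) (g t * arcsine_pdf t)%:E)%E.
Proof.
have mI : measurable (`[a, b]%classic : set R) by [].
rewrite -Rint_EFin; last exact: integrableR_indic.
rewrite integral_arcsine_prob; last exact: integrableR_indic.
rewrite [RHS]integral_mkcond; apply: eq_integral => t _.
by rewrite patchE indicE; case: ifP => _; rewrite ?mulr1// mulr0 mul0r.
Qed.

(** The density is singular at the end points of the support; exhausting the
    support by compact intervals keeps 2 - t^2 bounded away from zero. *)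
Lemma arcsine_exhaust (e : R) : 0 < e -> exists b c, [/\ 0 < b, 0 < c,
  forall t, t \in `[- b, b] -> c <= 2 - t ^+ 2 &
  \int[arcsine_prob R]_x g x <= \int[arcsine_prob R]_x (g x * \1_`[- b, b] x) + e].
Proof.
move=> e0.
pose c n : R := harmonic n.
pose b n : R := Num.sqrt (2 - c n).
have c0 n : 0 < c n by rewrite invr_gt0.
have c1 n : c n <= 1 by rewrite invf_le1// ler1n.
have b0 n : 0 < b n by rewrite sqrtr_gt0; have := c1 n; lra.
have bE n t : (t \in `[- b n, b n]) = (c n <= 2 - t ^+ 2).
  rewrite in_itv/= -ler_norml lerBrDr addrC -lerBrDr.
  rewrite -[t ^+ 2]real_normK ?num_real// -[2 - c n]sqr_sqrtr; last by have := c1 n; lra.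
  by rewrite ler_pXn2r ?nnegrE ?(ltW (b0 n)).
pose D : set R := [set t | t ^+ 2 < 2].
have mD : measurable D.
  rewrite (_ : D = `]- Num.sqrt 2, Num.sqrt 2[%classic)//.
  by apply/seteqP; split=> t; rewrite /D/= in_itv/= -ltr_norml sqr_lt2E.
have mI n : measurable (`[- b n, b n]%classic : set R) by [].
have cv : \int[arcsine_prob R]_x (g x * \1_`[- b n, b n] x) @[n --> \oo] -->
    \int[arcsine_prob R]_x (g x * \1_D x).
  apply: (@dominated_cvg_Rint _ _ _ _ g).
  - by move=> n; apply: integrableR_meas; exact: (integrableR_indic (arcsine_prob R) (mI n)).
  - by apply: integrableR_meas; exact: (integrableR_indic (arcsine_prob R) mD).
  - move=> x; apply: cvg_near_cst.
    have [x2|x2] := ltP (x ^+ 2) 2.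
      have cvh : c n @[n --> \oo] --> (0 : R) by exact: cvg_harmonic.
      have x20 : 0 < 2 - x ^+ 2 by rewrite subr_gt0.
      near=> n; rewrite !indicE; congr (_ * _%:R).
      rewrite [in RHS]mem_set// mem_set//=.
      rewrite bE ltW//; near: n.
      exact: (cvgr_lt _ cvh).
    near=> n; rewrite !indicE; congr (_ * _%:R).
    rewrite [in RHS]memNset ?memNset//=; last by rewrite /D/=; apply/negP; rewrite -leNgt.
    by apply/negP; rewrite bE -ltNge (le_lt_trans _ (c0 n))// subr_le0.
  - exact: integrableR_continuous_bounded.
  - move=> n x; rewrite ger0_norm ?mulr_ge0// ler_piMr// indicE.
have DE : \int[arcsine_prob R]_x (g x * \1_D x) = \int[arcsine_prob R]_x g x.
  apply: EFin_inj; rewrite -!Rint_EFin; [|exact: integrableR_continuous_bounded|exact: integrableR_indic].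
  rewrite !integral_arcsine_prob; [|exact: integrableR_continuous_bounded|exact: integrableR_indic].
  apply: eq_integral => t _; rewrite /arcsine_pdf; case: ifPn => [tI|_]; last by rewrite !mulr0.
  rewrite indicE mem_set ?mulr1// /D/=.
  by rewrite sqr_lt2E ltr_norml.
rewrite DE in cv.
have [n hn] : exists n, \int[arcsine_prob R]_x g x - e <= \int[arcsine_prob R]_x (g x * \1_`[- b n, b n] x).
  have /cvgrPdist_le/(_ _ e0)[n _ /(_ n (leqnn n))/= h] := cv.
  by exists n; move: h => /(le_trans (ler_norm _)); lra.
exists (b n), (c n); split => //; first by move=> t; rewrite bE.
by rewrite -lerBlDr.
Unshelve. all: by end_near. Qed.

(** If F^2 is close to t^2 - 2 at height y above [-b, b], then the density of
    mu smoothed at scale y is at least nearly the arcsine density there. By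
    Fubini's theorem the smoothing can be moved to g, where it costs little. *)
Lemma arcsine_le_of_approx (mu : borel_probability R) (y d e b c h : R) :
  0 < y -> 0 < d -> 0 <= e -> 0 < b -> 0 < c -> 0 <= h -> h <= c ->
  (forall t, t \in `[- b, b] -> c <= 2 - t ^+ 2) ->
  (forall t x, t \in `[- b, b] -> `|t - x| < d -> `|g t - g x| <= e) ->
  (forall t, t \in `[- b, b] ->
    normc (reciprocal_cauchy mu (t +i* y) ^+ 2 + (2 - t ^+ 2)%:C) <= h) ->
  (1 - 2 * (h / c)) * \int[arcsine_prob R]_x (g x * \1_`[- b, b] x) <=
  \int[mu]_x g x + (e + B * (y / pi / d ^+ 2) * (b - - b)).
Proof.
move=> y0 d0 e0 b0 c0 h0 hc bc gd Fh.
have bb : - b < b by rewrite gtrN.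
have gi := integrableR_continuous_bounded mu.
have [q0|q0] := leP (1 - 2 * (h / c)) 0.
  apply: (@le_trans _ _ 0).
    by rewrite mulr_le0_ge0// Rint_ge0// => x; rewrite mulr_ge0.
  have B0 : 0 <= B by exact: le_trans (g0 0) (gB 0).
  rewrite addr_ge0 ?Rint_ge0// addr_ge0// mulr_ge0//; last lra.
  by rewrite mulr_ge0// !divr_ge0 ?pi_ge0 ?exprn_ge0// ltW.
rewrite -lee_fin EFinM integral_arcsine_itv.
have mI : measurable (`[- b, b]%classic : set R) by [].
have md : measurable_fun `[- b, b]%classic (fun t => g t * arcsine_pdf t).
  apply: measurable_funTS; apply: measurable_funM => //; exact: measurable_arcsine_pdf.
rewrite -ge0_integralZl//; last 3 first.
- exact/measurable_EFinP.
- by move=> t _; rewrite lee_fin mulr_ge0 ?arcsine_pdf_ge0.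
- by rewrite lee_fin ltW.
apply: (@le_trans _ _ (\int[leb]_(t in `[(- b)%R, b]) (g t * stieltjes_density mu y t)%:E)%E).
  apply: ge0_le_integral => //.
  - by move=> t _; rewrite -EFinM lee_fin mulr_ge0 ?(ltW q0)// mulr_ge0 ?arcsine_pdf_ge0.
  - by apply: emeasurable_funM => //; exact/measurable_EFinP.
  - apply/measurable_EFinP; apply: measurable_funTS; apply: measurable_funM => //.
    exact: measurable_stieltjes_density.
  - move=> t tI; rewrite -EFinM lee_fin mulrCA ler_wpM2l//.
    have tI' : t \in `[- b, b] by [].
    have ct := bc t tI'; have cc : 0 < 2 - t ^+ 2 by lra.
    have z0 : 0 < Im (t +i* y) by [].
    have F0 := Im_iter_gt0 mu 1 z0.
    have hc' : h <= 2 - t ^+ 2 by lra.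
    have := Im_div_sqr_ge F0 cc h0 hc' (Fh t tI').
    rewrite /= -/(reciprocal_cauchy mu (t +i* y)).
    have -> : Im (reciprocal_cauchy mu (t +i* y)) / normc (reciprocal_cauchy mu (t +i* y)) ^+ 2
      = pi * stieltjes_density mu y t.
      rewrite /stieltjes_density [RHS]mulrC divfK; last by rewrite gt_eqF ?pi_gt0.
      have -> : cauchy_transform mu (t +i* y) = (reciprocal_cauchy mu (t +i* y))^-1.
        by rewrite /reciprocal_cauchy invrK.
      by move: (reciprocal_cauchy _ _) => w; rewrite cImV mulNr opprK.
    have t2 : - Num.sqrt 2 < t < Num.sqrt 2 by rewrite -ltr_norml -sqr_lt2E; lra.
    rewrite /arcsine_pdf t2 => ht.
    have -> : (1 - 2 * (h / c)) * (pi * Num.sqrt (2 - t ^+ 2))^-1 =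
      (1 - 2 * (h / c)) / Num.sqrt (2 - t ^+ 2) / pi by rewrite invfM [LHS]mulrA [LHS]mulrAC.
    rewrite ler_pdivrMr ?pi_gt0//.
    rewrite [leRHS]mulrC; apply: le_trans ht.
    rewrite ler_wpM2r ?invr_ge0 ?sqrtr_ge0// lerD2l lerN2 ler_pM2l//.
    by rewrite ler_wpM2l// lef_pV2 ?posrE.
rewrite -poisson_fubini//.
apply: (@le_trans _ _ (\int[mu]_x (g x + (e + B * (y / pi / d ^+ 2) * (b - - b)))%:E)%E).
  apply: ge0_le_integral => //.
  - by move=> x _; apply: integral_ge0 => t _; rewrite lee_fin mulr_ge0 ?poisson_ge0.
  - by apply: measurable_poisson_average.
  - by apply/measurable_EFinP; apply: measurable_funD.
  - by move=> x _; rewrite addrA; exact: poisson_average_le.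
rewrite Rint_EFin; last by apply: integrableRD => //; exact: integrableR_cst.
by rewrite RintD// ?Rint_cst//; exact: integrableR_cst.
Qed.

End arcsine_lower_bound.

(** * Weak convergence *)

Section weak_limit.
Context {R : realType}.
Notation Re := complex.Re.
Notation Im := complex.Im.

Lemma has_moment_even (mu : borel_probability R) p : ~~ odd p ->
  (\int[mu]_x (x ^+ p)%:E)%E \is a fin_num -> has_moment mu p.
Proof.
move=> op fp; apply/integrableP; split.
  by apply/measurable_EFinP; exact: measurable_pow.
under eq_integral do rewrite /= ger0_norm ?exprn_even_ge0//.
by rewrite ltey_eq fp.
Qed.

Lemma expectation_moment (mu : borel_probability R) : has_moment mu 1 ->
  ('E_mu[(idfun : R -> R)] = (moment mu 1)%:E)%E.
Proof. by move=> h1; rewrite unlock -Rint_EFin. Qed.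

(** A variance of one is a finite integral of x^2, which makes the mean an
    actual integral. *)
Lemma variance_moment (mu : borel_probability R) :
  ('E_mu[(idfun : R -> R)] = 0)%E -> ('V_mu[(idfun : R -> R)] = 1)%E ->
  [/\ has_moment mu 2, moment mu 1 = 0 & moment mu 2 = 1].
Proof.
move=> E0; rewrite /variance unlock E0 unlock /=.
have -> : (\int[mu]_w (((idfun \- cst 0) * (idfun \- cst 0)) w)%:E =
           \int[mu]_x (x ^+ 2)%:E)%E.
  by apply: eq_integral => x _ /=; congr (_%:E); rewrite /GRing.mul/= subr0.
move=> V1; have h2 : has_moment mu 2 by apply: has_moment_even => //; rewrite V1.
split => //.
  by apply: EFin_inj; rewrite -expectation_moment//; exact: has_moment_le h2.
by apply: EFin_inj; rewrite -Rint_EFin.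
Qed.

Variable mu : nat -> borel_probability R.
Hypothesis mu_ID : forall n, (0 < n)%N -> monotone_infinitely_divisible (mu n).
Hypothesis mu_2 : forall n, (0 < n)%N -> has_moment (mu n) 2.
Hypothesis mu_1 : forall n, (0 < n)%N -> moment (mu n) 1 = 0.
Hypothesis mu_var : forall n, (0 < n)%N -> moment (mu n) 2 = 1.
Hypothesis mu_4 : \forall n \near \oo, has_moment (mu n) 4.
Hypothesis mu_4cvg : moment (mu n) 4 @[n --> \oo] --> (3 / 2 : R).

(** With th proportional to h, [reciprocal_cauchy_arcsine_bound] is below h as
    soon as m4 - 3 / 2 is below th^2. The term y^2 + 4 y bounds |z^2 - t^2|. *)
Lemma near_reciprocal_cauchy (y h : R) : 0 < y -> 0 < h ->
  \forall n \near \oo, forall t, t ^+ 2 <= 2 ->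
    normc (reciprocal_cauchy (mu n) (t +i* y) ^+ 2 + (2 - t ^+ 2)%:C) <=
    h + (y ^+ 2 + 4 * y).
Proof.
move=> y0 h0; pose th := h * y / 2.
have th0 : 0 < th by rewrite divr_gt0// mulr_gt0.
near=> n => t t2.
have n0 : (0 < n)%N by near: n; exact: nbhs_infty_gt.
have z0 : 0 < Im (t +i* y) by [].
have n4 : has_moment (mu n) 4 by near: n.
have := reciprocal_cauchy_arcsine_bound (mu_ID n0) n4 (mu_1 n0) (mu_var n0) th0 z0.
set w := reciprocal_cauchy _ _; set m := moment (mu n) 4.
have mth : m - 3 / 2 <= th ^+ 2.
  rewrite lerBlDr ltW// /m; near: n; apply: (cvgr_lt _ mu_4cvg).
  by rewrite ltrDr exprn_gt0.
move=> hw.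
have {}hw : normc (w ^+ 2 - (t +i* y) ^+ 2 + 2) <= h.
  apply: (le_trans hw); rewrite ler_pdivrMr//=.
  have : (m - 3 / 2) / th <= th by rewrite ler_pdivrMr// -expr2.
  rewrite /th; lra.
have -> : w ^+ 2 + (2 - t ^+ 2)%:C =
  (w ^+ 2 - (t +i* y) ^+ 2 + 2) + ((- y ^+ 2) +i* (2 * t * y)).
  rewrite rmorphB/= rmorph_nat -!addrA; congr (_ + _).
  rewrite addrCA; congr (_ + _).
  by apply: complex_eq; rewrite ?(cReD, cImD, cReN, cImN) !expr2 ?(cReM, cImM)/=; ring.
rewrite (le_trans (normc_le_add _ _))// lerD//.
have t_le2 : `|t| <= 2 by rewrite -ler_sqr ?nnegrE// real_normK ?num_real//; lra.
have -> : - y ^+ 2 +i* (2 * t * y) = (- y ^+ 2)%:C + 'i%C * (2 * t * y)%:C.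
  by apply: complex_eq; rewrite ?(cReD, cImD) ?(cReM, cImM)/=; ring.
rewrite (le_trans (normc_le_add _ _))// normcM !normc_real normrN ger0_norm ?sqr_ge0//.
rewrite lerD2l /= expr0n/= expr1n add0r sqrtr1 mul1r !normrM (gtr0_norm y0) ger0_norm//.
by rewrite ler_pM2r//; lra.
Unshelve. all: by end_near. Qed.

(** The lower half of the portmanteau theorem. The parameters are chosen in the
    order: an interval inside the support, a scale y, and then n. *)
Lemma arcsine_le_liminf (g : R -> R) (B e : R) : continuous g ->
  (forall x, 0 <= g x) -> (forall x, g x <= B) -> 0 < e ->
  \forall n \near \oo, \int[arcsine_prob R]_x g x <= \int[mu n]_x g x + e.
Proof.
move=> gc g0 gB e0.
have B0 : 0 <= B by exact: le_trans (g0 0) (gB 0).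
have e4 : 0 < e / 4 by rewrite divr_gt0.
have [b [c [b0 c0 bc ec]]] := arcsine_exhaust gc g0 gB e4.
have [d d0 gd] := continuous_near_itv (- b) b gc e4.
have pi0 := @pi_gt0 R.
(* Four errors of size e / 4: the ends of the support, the modulus of continuity,
   the tail A y of the Poisson kernel, and the relative error 2 h / c. *)
pose A := B * (pi^-1 / d ^+ 2) * (b - - b).
have A0 : 0 <= A.
  rewrite mulr_ge0//; last lra.
  by rewrite mulr_ge0// divr_ge0 ?invr_ge0 ?exprn_ge0 ?(ltW pi0)// ltW.
pose h := Num.min c (c * e / (8 * (B + 1))).
have h0 : 0 < h by rewrite lt_min c0/= divr_gt0 ?mulr_gt0//; lra.
have hc : h <= c by rewrite ge_min lexx.
have hB : 2 * (h / c) * B <= e / 4.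
  have : h <= c * e / (8 * (B + 1)) by rewrite ge_min lexx orbT.
  rewrite ler_pdivlMr; last by rewrite mulr_gt0//; lra.
  move=> hh; have -> : 2 * (h / c) * B = 2 * h * B / c by ring.
  rewrite ler_pdivrMr//; have := mulr_ge0 (ltW h0) B0; lra.
pose y := Num.min 1 (Num.min (h / 10) (e / (4 * (A + 1)))).
have y0 : 0 < y by rewrite !lt_min ltr01/= !divr_gt0// mulr_gt0//; lra.
have y1 : y <= 1 by rewrite ge_min lexx.
have yh : y <= h / 10 by rewrite !ge_min lexx orbT.
have yA : A * y <= e / 4.
  have : y <= e / (4 * (A + 1)) by rewrite !ge_min lexx !orbT.
  rewrite ler_pdivlMr; last by rewrite mulr_gt0//; lra.
  by lra.
have h2 : 0 < h / 2 by rewrite divr_gt0.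
near=> n.
have Fh t : t \in `[- b, b] ->
    normc (reciprocal_cauchy (mu n) (t +i* y) ^+ 2 + (2 - t ^+ 2)%:C) <= h.
  move=> tb; have := bc t tb => ct.
  have : forall t, t ^+ 2 <= 2 ->
    normc (reciprocal_cauchy (mu n) (t +i* y) ^+ 2 + (2 - t ^+ 2)%:C) <=
    h / 2 + (y ^+ 2 + 4 * y) by near: n; exact: near_reciprocal_cauchy.
  move=> /(_ t) /(_ _)/le_trans; apply; first lra.
  have : y ^+ 2 <= y by rewrite expr2 ler_piMr// ltW.
  lra.
have := arcsine_le_of_approx gc g0 gB y0 d0 (ltW e4) b0 c0 (ltW h0) hc bc gd Fh.
have -> : B * (y / pi / d ^+ 2) * (b - - b) = A * y by rewrite /A; ring.
set X := \int[arcsine_prob R]_x (g x * _).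
have XB : X <= B.
  rewrite -(@Rint_cst _ (arcsine_prob R) B); apply: Rint_le.
  - by apply: (integrableR_indic gc g0 gB).
  - exact: integrableR_cst.
  - by move=> x; rewrite (le_trans _ (gB x))// ler_piMr// indicE.
have X0 : 0 <= X by apply: Rint_ge0 => x; rewrite mulr_ge0.
have : 2 * (h / c) * X <= 2 * (h / c) * B.
  by rewrite ler_wpM2l// mulr_ge0// divr_ge0// ltW.
move: (2 * (h / c)) hB => q hB h3 h4.
rewrite -/X in ec; lra.
Unshelve. all: by end_near. Qed.

(** As all measures have total mass one, the lower bound for B - f is an upper
    bound for f. *)
Lemma weak_cvg_arcsine : weak_cvg mu (arcsine_prob R).
Proof.
move=> f fc fb.
have [B fB] : exists B, forall x, `|f x| <= B.
  have [M [_ hM]] := fb; exists (M + 1) => x.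
  by apply: hM => //; rewrite ltrDl.
have fi (nu : borel_probability R) : integrableR nu f.
  by apply: (@integrableR_bounded _ _ B) => //; exact: continuous_measurable_fun.
have ci (nu : borel_probability R) : integrableR nu (fun=> B) by exact: integrableR_cst.
apply/cvgrPdist_le => e e0.
near=> n.
rewrite ler_norml; apply/andP; split.
  have : \int[arcsine_prob R]_x (B - f x) <= \int[mu n]_x (B - f x) + e.
    near: n; apply: (@arcsine_le_liminf _ (2 * B)) => //.
    - by move=> x; apply: cvgB; [exact: cvg_cst|exact: fc].
    - by move=> x; have := fB x; rewrite ler_norml; lra.
    - by move=> x; have := fB x; rewrite ler_norml; lra.
  rewrite !RintB// !Rint_cst; lra.
have : \int[arcsine_prob R]_x (B + f x) <= \int[mu n]_x (B + f x) + e.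
  near: n; apply: (@arcsine_le_liminf _ (2 * B)) => //.
  - by move=> x; apply: cvgD; [exact: cvg_cst|exact: fc].
  - by move=> x; have := fB x; rewrite ler_norml; lra.
  - by move=> x; have := fB x; rewrite ler_norml; lra.
rewrite !RintD// !Rint_cst; lra.
Unshelve. all: by end_near. Qed.

End weak_limit.

Theorem theorem1p5 (R : realType) (mu : nat -> borel_probability R)
    (mean_mu : forall n : nat, (0 < n)%N ->
      ('E_(mu n)[(idfun : R -> R)] = 0)%E)
    (variance_mu : forall n : nat, (0 < n)%N ->
      ('V_(mu n)[(idfun : R -> R)] = 1)%E)
    (id_mu : forall n : nat, (0 < n)%N -> monotone_infinitely_divisible (mu n))
    (moment4 : (\int[mu n]_x (x ^+ 4)%:E)%E @[n --> \oo] --> (3 / 2 : R)%:E) :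
  weak_cvg mu (arcsine_prob R).
Proof.
have mom n : (0 < n)%N -> [/\ has_moment (mu n) 2, moment (mu n) 1 = 0 & moment (mu n) 2 = 1].
  by move=> n0; apply: variance_moment; [exact: mean_mu|exact: variance_mu].
have [fin4 cvg4] := (fine_cvgP _ _).1 moment4.
apply: weak_cvg_arcsine => //.
- by move=> n /mom[].
- by move=> n /mom[].
- by apply: filterS fin4 => n; exact: has_moment_even.
Qed.
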